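(* Let $(Z,d_Z)$ be a $(\xi,K,L,\{\gamma_k\}_{k\in K})$-tree of geodesic coarsely convex spaces. Suppose that $Z$ is proper. For $k\in K$, set $X_k:=\xi^{-1}(\mathrm{star}(k))$. Then $$\dim(\partial Z) = \sup\{\dim (\partial X_k):k\in K\}.$$
   Context: **Geodesic coarsely convex bicombings.** A geodesic bicombing on a metric space $(X,d)$ is a map $\gamma:X\times X\times[0,1]\to X$ with $\gamma(x,y,0)=x$, $\gamma(x,y,1)=y$ and $d(\gamma(x,y,t),\gamma(x,y,s))=|t-s|\,d(x,y)$. For $E\ge 1$, $C\ge 0$, it is $(E,C)$-geodesic coarsely convex if for all $x_1,x_2,y_1,y_2\in X$ and $a,b,c\in[0,1]$, putting $y_1'=\gamma(x_1,y_1,a)$, $y_2'=\gamma(x_2,y_2,b)$, we have $d(\gamma(x_1,y_1,ca),\gamma(x_2,y_2,cb))\le (1-c)E\,d(x_1,x_2)+cE\,d(y_1',y_2')+C$. **Ideal boundary.** Let $X$ carry an $(E,C)$-geodesic coarsely convex bicombing $\gamma$ and a base point $e$. Put $\hat\gamma(x,y,t)=\gamma(x,y,t/d(x,y))$ for $0\le t\le d(x,y)$, $x\neq y$, and $\hat\gamma(x,y,t)=y$ otherwise. Set $D=2(1+E)+C$, $D_1=2D+2$, and for $x,y\in X$ let $(x\mid y)_e=\min\{d(e,x),d(e,y),\sup\{t\ge 0: d(\hat\gamma(e,x,t),\hat\gamma(e,y,t))\le D_1\}\}$. Let $S_\infty(X)$ be the set of sequences $(x_i)$ in $X$ with $(x_i\mid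 x_j)_e\to\infty$ as $i,j\to\infty$; $(x_i)\sim(y_i)$ iff $(x_i\mid y_i)_e\to\infty$. The ideal boundary is $\partial X=S_\infty(X)/\sim$, and $\overline X=X\cup\partial X$. Extend the product to $\overline X$ by $(x\mid y)=\sup\{\liminf_i (x_i\mid y_i)_e: (x_i)\in x,(y_i)\in y\}$, where for $x\in X$ ''$(x_i)\in x$'' means $x_i=x$ for all $i$. The sets $V_n=\{(x,y)\in\overline X^2:(x\mid y)>n\}\cup\{(x,y)\in X^2:d(x,y)<1/n\}$, $n\in\mathbb{N}$, form a base of a metrizable uniformity on $\overline X$; $\overline X$ has the induced topology and $\partial X$ the subspace topology. **Trees of spaces.** Let $(Z,d_Z)$ be a geodesic metric space, $T$ a bipartite tree with vertex set $V(T)=K\sqcup L$, and $\xi:Z\to T$ continuous. For $k\in K$, $\mathrm{star}(k)$ is the closed star of $k$ (union of the closed edges containing $k$). $Z$ is a tree of spaces (associated with $\xi$, $K$, $L$) if $\xi^{-1}(l)$ is a single point for each $l\in L$ and $X_k=\xi^{-1}(\mathrm{star}(k))$ is a geodesic space for each $k\in K$. It is a $(\xi,K,L,\{\gamma_k\})$-tree of geodesic coarsely convex spaces if, for constants $E'\ge1$, $C'\ge0$ independent of $k$, each $\gamma_k$ is an $(E',C')$-geodesic coarsely convex bicombing on $X_k$. The associated bicombing $\gamma$ on $Z$: if $x,y$ lie in a common $X_k$, $\gamma(x,y,\cdot)=\gamma_k(x,y,\cdot)$; otherwise, if $l_1,\dots,l_m\in L$ are the $L$-vertices met in order by the geodesic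 of $T$ from $\xi(x)$ to $\xi(y)$ and $\{p_i\}=\xi^{-1}(l_i)$, then $\gamma(x,y,\cdot)$ is the concatenation of the $\gamma_k$-geodesics between consecutive points of $x,p_1,\dots,p_m,y$ (in the $X_k$ containing both), parametrized proportionally to arc length. It is a geodesic coarsely convex bicombing, and $\partial Z$ is taken with respect to it; $\partial X_k$ is taken with respect to $\gamma_k$. **Dimension.** $\dim V$ is the topological (covering) dimension: for an integer $n\ge 0$, $\dim V\le n$ means that every finite open cover of $V$ has a finite open refinement in which every point lies in at most $n+1$ members. *)

(* Defs.v *)
From HB Require Import structures.
From mathcomp Require Import all_boot all_order all_algebra.
From mathcomp Require Import all_classical all_reals all_analysis.

Set Implicit Arguments.
Unset Strict Implicit.
Unset Printing Implicit Defensive.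

Import Order.TTheory GRing.Theory Num.Theory.
Import numFieldNormedType.Exports.

Local Open Scope classical_set_scope.
Local Open Scope ring_scope.

(* A subset of a metric space, seen as a type, with the restricted metric;
   MathComp-Analysis stops at the pseudometric structure on [set_type]. *)
Section subset_metric.
Context {R : realType} {X : metricType R} (A : set X).

Let sub_mdist (x y : A) : R := mdist (set_val x) (set_val y).

Let sub_mdist_ge0 x y : 0 <= sub_mdist x y.
Proof. exact: mdist_ge0. Qed.

Let sub_mdist_positivity x y : sub_mdist x y = 0 -> x = y.
Proof. by move/mdist_positivity => xy; apply: val_inj. Qed.

Let sub_ballEmdist (x : A) d : ball x d = [set y | sub_mdist x y < d].
Proof. by rewrite -initial_ballE ballEmdist. Qed.

HB.instance Definition _ := @PseudoMetric_isMetric.Build R (set_type A)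
  sub_mdist sub_mdist_ge0 sub_mdist_positivity sub_ballEmdist.

End subset_metric.

Section metric_spaces.
Context {R : realType}.

Definition geodesic_space (X : metricType R) := forall x y : X,
  exists g : R -> X, [/\ g 0 = x, g 1 = y &
    forall s t, 0 <= s <= 1 -> 0 <= t <= 1 ->
      mdist (g s) (g t) = `|s - t| * mdist x y].

Definition proper_space (X : metricType R) :=
  forall (x : X) (r : R), compact [set y : X | mdist x y <= r].

(* The parameter is a real number, but only its values in [0, 1] matter. *)
Definition bicombing (X : metricType R) := X -> X -> R -> X.

Definition geodesic_bicombing (X : metricType R) (g : bicombing X) :=
  forall x y, [/\ g x y 0 = x, g x y 1 = y &
    forall t s, 0 <= t <= 1 -> 0 <= s <= 1 ->
      mdist (g x y t) (g x y s) = `|t - s| * mdist x y].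

Definition geodesic_coarsely_convex (X : metricType R) (E C : R)
    (g : bicombing X) :=
  [/\ 1 <= E, 0 <= C, geodesic_bicombing g &
    forall (x1 x2 y1 y2 : X) (a b c : R),
      0 <= a <= 1 -> 0 <= b <= 1 -> 0 <= c <= 1 ->
      mdist (g x1 y1 (c * a)) (g x2 y2 (c * b)) <=
        (1 - c) * E * mdist x1 x2
        + c * E * mdist (g x1 y1 a) (g x2 y2 b) + C].

(* Arc length parametrization, constant after the time [mdist x y]. *)
Definition arclength_geod (X : metricType R) (g : bicombing X)
    (x y : X) (t : R) : X :=
  if (x != y) && (t <= mdist x y) then g x y (t / mdist x y) else y.

End metric_spaces.

Section ideal_boundary.
Context {R : realType} {X : metricType R}.
Variables (e : X) (g : bicombing X) (E C : R).

Definition cst_D : R := 2 * (1 + E) + C.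
Definition cst_D1 : R := 2 * cst_D + 2.

(* The set of times below is unbounded when [mdist x y <= cst_D1], hence the
   supremum in the extended reals. *)
Definition gromov_prod (x y : X) : \bar R :=
  mine (mdist e x)%:E (mine (mdist e y)%:E
    (ereal_sup [set t%:E | t in [set t : R | 0 <= t /\
       mdist (arclength_geod g e x t) (arclength_geod g e y t) <= cst_D1]])).

Definition S_infty : set (nat -> X) :=
  [set u | gromov_prod (u ij.1) (u ij.2) @[ij --> filter_prod \oo \oo]
             --> +oo%E].

Definition S_infty_equiv (u v : nat -> X) :=
  gromov_prod (u i) (v i) @[i --> \oo] --> +oo%E.

(* The quotient of [S_infty] by [S_infty_equiv], as a type of classes. *)
Definition ideal_boundary : Type :=
  set_type [set c : set (nat -> X) |
    exists2 u, S_infty u & c = [set v | S_infty v /\ S_infty_equiv u v]].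

Definition compactification : Type := (X + ideal_boundary)%type.

Definition representatives (a : compactification) : set (nat -> X) :=
  match a with
  | inl x => [set fun=> x]
  | inr c => set_val c
  end.

Definition ext_gromov_prod (a b : compactification) : \bar R :=
  ereal_sup [set limn_einf (fun i => gromov_prod (uv.1 i) (uv.2 i)) |
              uv in representatives a `*` representatives b].

Definition base_entourage (n : nat) : set (compactification * compactification) :=
  [set ab | (n%:R%:E < ext_gromov_prod ab.1 ab.2)%E] `|`
  [set ab | exists x y, ab = (inl x, inl y) /\ mdist x y < n%:R^-1].

(* Open sets of the uniformity with base [base_entourage n], [n >= 1].  The
   index 0 is excluded: 1/n makes no sense for it. *)
Definition compactification_open : set_system compactification :=
  [set O | forall a, O a -> exists2 n, (0 < n)%N &
             forall b, base_entourage n (a, b) -> O b].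

Lemma base_entourage_le m n : (0 < m <= n)%N ->
  base_entourage n `<=` base_entourage m.
Proof.
move=> /andP[m0 mn] ab [abn|[x [y [-> xyn]]]]; [left|right].
- by apply: le_lt_trans abn; rewrite lee_fin ler_nat.
- exists x, y; split=> //; apply: (lt_le_trans xyn).
  by rewrite lef_pV2 ?ler_nat// posrE ltr0n// (leq_trans m0 mn).
Qed.

Let compactification_openT : compactification_open setT.
Proof. by move=> a _; exists 1%N. Qed.

Let compactification_openI : setI_closed compactification_open.
Proof.
move=> A B oA oB a [/oA[m m0 mA] /oB[n n0 nB]].
exists (maxn m n); first by rewrite leq_max m0.
move=> b ab; split.
- by apply/mA/(base_entourage_le _ ab); rewrite m0 leq_maxl.
- by apply/nB/(base_entourage_le _ ab); rewrite n0 leq_maxr.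
Qed.

Let compactification_open_bigU (I : Type) (f : I -> set compactification) :
  (forall i, compactification_open (f i)) ->
  compactification_open (\bigcup_i f i).
Proof.
move=> of_ a [i _ /(of_ i)[n n0 nf]]; exists n => // b /nf fb.
by exists i.
Qed.

HB.instance Definition _ := gen_eqMixin compactification.
HB.instance Definition _ := gen_choiceMixin compactification.
HB.instance Definition _ := isOpenTopological.Build compactification
  compactification_openT compactification_openI compactification_open_bigU.

HB.instance Definition _ := gen_eqMixin ideal_boundary.
HB.instance Definition _ := gen_choiceMixin ideal_boundary.

HB.instance Definition _ := Topological.copy ideal_boundary
  (initial_topology (inr : ideal_boundary -> compactification)).

End ideal_boundary.

Section dimension.
Variable R : realType.

Definition finite_open_cover (V : topologicalType) (U : set (set V)) :=
  [/\ finite_set U, U `<=` open & \bigcup_(A in U) A = setT].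

Definition refines (V : Type) (W U : set (set V)) :=
  forall B, W B -> exists2 A, U A & B `<=` A.

Definition dim_le (V : topologicalType) (n : nat) :=
  forall U : set (set V), finite_open_cover U ->
    exists W : set (set V), [/\ finite_open_cover W, refines W U &
      forall x : V, ([set B | W B /\ B x] #<= `I_n.+1)%card].

(* With values in {0, 1, 2, ..., +oo}; in particular the empty space has
   dimension 0. *)
Definition covering_dim (V : topologicalType) : \bar R :=
  ereal_inf [set n%:R%:E | n in [set n : nat | dim_le V n]].

(* Supremum in [0, +oo]: it is 0 for the empty family. *)
Definition sup_dim (I : Type) (d : I -> \bar R) : \bar R :=
  ereal_sup ([set 0%E] `|` range d).

End dimension.

Section trees.
Context {K L : choiceType}.
Variable adj : K -> L -> bool.

(* The graph with vertex set the disjoint sum of [K] and [L]. *)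
Definition bip_edge : rel (K + L)%type := fun u v =>
  match u, v with
  | inl k, inr l | inr l, inl k => adj k l
  | _, _ => false
  end.

Definition bipartite_tree :=
  [/\ exists v : (K + L)%type, True,
      forall u v, exists2 p, path bip_edge u p & last u p = v &
      forall c, cycle bip_edge c -> uniq c -> (size c <= 2)%N].

Variable R : realType.

(* Points of the geometric realization are given by their barycentric
   coordinates on the vertices.  The topology of pointwise convergence of the
   coordinates coincides on the realization with that of the path metric with
   unit edges. *)
Definition vertex_pt (v : K + L) : {ptws (K + L)%type -> R} :=
  fun u => (u == v)%:R.

Definition edge_pt (k : K) (l : L) (s : R) : {ptws (K + L)%type -> R} :=
  fun u => (1 - s) * vertex_pt (inl k) u + s * vertex_pt (inr l) u.

Definition closed_edge k l : set {ptws (K + L)%type -> R} :=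
  edge_pt k l @` `[0, 1].

Definition realization : set {ptws (K + L)%type -> R} :=
  range vertex_pt `|`
  \bigcup_(kl in [set kl : K * L | adj kl.1 kl.2]) closed_edge kl.1 kl.2.

(* [k] itself is added, for the case where it is an isolated vertex. *)
Definition closed_star (k : K) : set {ptws (K + L)%type -> R} :=
  [set vertex_pt (inl k)] `|` \bigcup_(l in [set l | adj k l]) closed_edge k l.

(* [ws] lists in order the vertices met by the geodesic from [a] to [b], for
   [a] and [b] not in the interior of the same edge: it is a simple path, from
   a vertex of the smallest cell containing [a] to one of the smallest cell
   containing [b], with no other vertex in these two cells. *)
Definition geodesic_vertices (a b : {ptws (K + L)%type -> R})
    (ws : seq (K + L)) :=
  match ws with
  | [::] => False
  | w :: p =>
    [/\ path bip_edge w p && uniq (w :: p), 0 < a w, 0 < b (last w p),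
        forall v, v \in w :: p -> 0 < a v -> v = w &
        forall v, v \in w :: p -> 0 < b v -> v = last w p]
  end.

End trees.

Arguments realization {K L} adj R.
Arguments vertex_pt {K L R} v _.
Arguments closed_edge {K L R} k l _.
Arguments closed_star {K L} adj {R} k _.

Section trees_of_spaces.
Context {R : realType} {Z : metricType R} {K L : choiceType}.
Context {adj : K -> L -> bool}.
Variable xi : Z -> realization adj R.

Definition piece (k : K) : set Z := [set z | closed_star adj k (set_val (xi z))].

Definition L_fiber (l : L) : set Z :=
  [set z | set_val (xi z) = vertex_pt (inr l)].

Definition tree_of_spaces :=
  [/\ geodesic_space Z, bipartite_tree adj, continuous xi,
      forall l, exists p, L_fiber l = [set p] &
      forall k, geodesic_space (piece k)].

Variable gk : forall k, bicombing (piece k).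

Definition tree_of_gcc_spaces (E C : R) :=
  tree_of_spaces /\ forall k, geodesic_coarsely_convex E C (@gk k).

(* [gk x y] computed in a piece containing both [x] and [y] (junk if there is
   none).  Two distinct points lie in at most one common piece. *)
Definition piece_bicombing : bicombing Z := fun x y t =>
  match pselect (exists k, piece k x /\ piece k y) with
  | left h =>
      let k := projT1 (cid h) in let h' := projT2 (cid h) in
      set_val (@gk k (SigSub (mem_set (proj1 h')))
                     (SigSub (mem_set (proj2 h'))) t)
  | right _ => y
  end.

(* The points p_1, ..., p_m of Z above the L-vertices met by the geodesic
   from [xi x] to [xi y]. *)
Definition cut_points (x y : Z) : seq Z :=
  pmap (fun w => if w is inr l then Some (xget x (L_fiber l)) else None)
    (xget [::] [set ws | geodesic_vertices adj (set_val (xi x))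
                           (set_val (xi y)) ws]).

Fixpoint chain_length (x : Z) (s : seq Z) : R :=
  if s is y :: s' then mdist x y + chain_length y s' else 0.

(* Point at arc length [u] on the concatenation of the geodesics joining the
   consecutive points of [x :: s]. *)
Fixpoint chain_point (x : Z) (s : seq Z) (u : R) : Z :=
  if s is y :: s' then
    if u <= mdist x y then arclength_geod piece_bicombing x y u
    else chain_point y s' (u - mdist x y)
  else x.

Definition tree_bicombing : bicombing Z := fun x y t =>
  if `[< exists k, piece k x /\ piece k y >] then piece_bicombing x y t
  else let s := rcons (cut_points x y) y in
       chain_point x s (t * chain_length x s).

End trees_of_spaces.

(* Main.v *)
Require Import Defs.
From HB Require Import structures.
From mathcomp Require Import all_boot all_order all_algebra.
From mathcomp Require Import all_classical all_reals all_analysis.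
From mathcomp Require Import lra.

Import Order.TTheory GRing.Theory Num.Theory.
Import numFieldNormedType.Exports.
Local Open Scope classical_set_scope.
Local Open Scope ring_scope.

(** The tree bicombing enters only through two facts: its paths are geodesics,
    hence pass through every cut point separating their ends, and it restricts
    to the given bicombing on each piece ([tree_bicombing_piece]).

    By coarse convexity, a large Gromov product means that geodesics from the
    base point are at bounded distance up to a large time, and neither the bound
    nor the base point matters ([fellow_gromov_prod], [gromov_prod_fellow],
    [fellow_basepoint]).  The boundary is thus a space with a countable base of
    entourages ([boundary_entourage_base]), compact since the space is proper
    ([boundary_compact]), and the inclusion of a piece induces an embedding of
    boundaries ([inclusion_embedding]).

    A cut point of the tree of spaces splits the boundary into clopen sets,
    because geodesics on either side of it diverge ([clopen_boundary_of]).  A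
    boundary point outside of the boundary of a piece is separated from it by
    one of its cut points ([boundary_beyond]); so the boundary of a piece is an
    intersection of clopen sets ([clopen_separated_inclusion]).  A point in the
    boundary of no piece is an end of the tree, behind cut points arbitrarily
    far away, and the corresponding clopen sets shrink to it
    ([clopen_separated_outside]).

    The compact boundary of the tree is therefore the union of closed sets, the
    boundaries of the pieces and single points, each of which is an
    intersection of clopen sets.  In such a space the dimension is the supremum
    of those of the closed sets: a closed set has no larger dimension
    ([dim_le_closed]), and conversely a good refinement of a cover on one of the
    closed sets extends with the same order to a neighborhood, which contains a
    clopen one, and finitely many of these can be made disjoint
    ([dim_le_clopen_separated]). *)

Set Implicit Arguments.
Unset Strict Implicit.
Unset Printing Implicit Defensive.

(** * Covering dimension of spaces with a countable base of entourages *)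

(** Compactness as induction over ideals of sets: were [A] not in the ideal [P],
    the complements of the members of [P] would generate a proper filter on [A]
    without cluster points. *)
Lemma compact_ideal (T : topologicalType) (A : set T) (P : set T -> Prop) :
  compact A -> P set0 -> (forall D D', P D -> P D' -> P (D `|` D')) ->
  (forall D D', D `<=` D' -> P D' -> P D) ->
  (forall x, A x -> exists2 D, nbhs x D & P D) -> P A.
Proof.
move=> cA P0 PU PS Pn; apply: contrapT => PA.
pose F : set_system T := [set B | P (A `\` B)].
have FF : ProperFilter F.
  split; first by rewrite /F/= setD0.
  split.
  - by rewrite /F/= setDT.
  - move=> B B' FB FB'; rewrite /F/=; apply: PS (PU _ _ FB FB').
    by move=> x [Ax nBB']; have [Bx|nBx] := pselect (B x);
      [right; split=> // B'x; exact: nBB'|left].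
  - by move=> B B' BB' FB; apply: PS FB => x [Ax nB']; split=> // /BB'.
have [x [Ax xF]] : A `&` cluster F !=set0.
  by apply: cA; rewrite /F/= setDv.
have [D xD PD] := Pn _ Ax.
have [] := xF (~` D) D => //.
  by rewrite /F/=; apply: PS PD => z [_] /contrapT.
by move=> z [].
Qed.

Lemma finite_set_max d (D : orderType d) (T : choiceType) (f : T -> D) (A : set T) :
  finite_set A -> A !=set0 -> exists2 x, A x & forall y, A y -> (f y <= f x)%O.
Proof.
move=> /finite_seqP[s ->{A}]; elim: s => [[]//|x s IH] _.
have [s0|ys] := pselect ([set` s] !=set0); last first.
  exists x; first by rewrite /= inE eqxx.
  move=> z /=; rewrite inE => /predU1P[->//|zs].
  by case: ys; exists z.
have [y ys ymax] := IH s0.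
have [xy|yx] := leP (f x) (f y).
  exists y; first by rewrite /= inE (ys : y \in s) orbT.
  by move=> z /=; rewrite inE => /predU1P[->//|/ymax].
exists x; first by rewrite /= inE eqxx.
move=> z /=; rewrite inE => /predU1P[->//|/ymax zy].
exact: le_trans zy (ltW yx).
Qed.

Definition entourage_base (V : topologicalType) (G : nat -> V -> V -> Prop) :=
  [/\ forall n a, G n a a,
      forall m n a b, (m <= n)%N -> G n a b -> G m a b,
      forall n, exists m, forall a b c, G m a b -> G m c b -> G n a c &
      forall O : set V, open O <->
        forall a, O a -> exists n, forall b, G n a b -> O b].

(** [phi] is a topological embedding, up to injectivity; the second clause
    is the topology of [B] measured by the entourages of [V]. *)
Definition entourage_embedding (B V : topologicalType)
    (G : nat -> V -> V -> Prop) (phi : B -> V) :=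
  continuous phi /\
  forall O : set B, open O -> forall a, O a ->
    exists n, forall b, G n (phi a) (phi b) -> O b.

Section entourages.
Context (V : topologicalType) (G : nat -> V -> V -> Prop).
Hypothesis GV : entourage_base G.

Lemma entourage_sym n : exists m, forall a b, G m a b -> G n b a.
Proof.
have [Gxx _ Gtr _] := GV; have [m mn] := Gtr n.
by exists m => a b ab; apply: (mn _ b).
Qed.

Lemma entourage_nbhs n a : nbhs a [set b | G n a b].
Proof.
have [Gxx Gle Gtr Gop] := GV.
pose O := [set x | exists m, forall b, G m x b -> G n a b].
have oO : open O.
  apply/Gop => x [m mx]; have [k km] := Gtr m; have [k' k'k] := entourage_sym k.
  exists (maxn k k') => y xy; exists (maxn k k') => b yb; apply: mx.
  apply: (km _ y); first by apply: Gle xy; rewrite leq_maxl.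
  by apply: k'k; apply: Gle yb; rewrite leq_maxr.
apply: (@filterS _ _ _ O).
  by move=> x [m mx]; apply: mx; apply: Gxx.
apply: open_nbhs_nbhs; split=> //; exists n.
by [].
Qed.

Variables (B : topologicalType) (phi : B -> V).
Hypothesis phiE : entourage_embedding G phi.

(** The entourage version of the set of points closer to [phi @` O] than to
    [phi @` (~` O)], which extends an open set of a subspace of a metric space
    to the whole space. *)
Definition swell (O : set B) : set V :=
  [set y | exists2 n, (exists2 a, O a & G n (phi a) y) &
                      forall c, ~ O c -> ~ G n (phi c) y]°.

Lemma open_swell O : open (swell O).
Proof. exact: open_interior. Qed.

Lemma preimage_swell O : open O -> phi @^-1` swell O = O.
Proof.
have [Gxx Gle Gtr Gop] := GV; have [phic phiO] := phiE.
move=> oO; apply/seteqP; split=> [b /interior_subset[n _ nb]|a Oa].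
  by apply: contrapT => /nb; apply; exact: Gxx.
have [n na] := phiO _ oO _ Oa; have [m mn] := Gtr n.
apply: filterS (entourage_nbhs m (phi a)) => y ay; exists m; first by exists a.
by move=> c nOc cy; apply/nOc/na; apply: mn cy.
Qed.

(** Swelling creates no new intersections.  A point of finitely many swollen
    sets sits in each at some scale; the witness at the finest of these scales
    is, at every other scale, too close to be outside of the other sets. *)
Lemma swell_inter (W : set (set B)) (y : V) : finite_set W -> W !=set0 ->
  (forall O, W O -> swell O y) -> exists a, forall O, W O -> O a.
Proof.
have [Gxx Gle Gtr Gop] := GV.
move=> finW; case=> O0 WO0 Wy.
have {}Wy O : W O -> exists n, (exists2 a, O a & G n (phi a) y) /\
    forall c, ~ O c -> ~ G n (phi c) y.
  by move=> /Wy/interior_subset[n]; exists n.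
have [sc scP] : {sc | forall O, W O -> (exists2 a, O a & G (sc O) (phi a) y) /\
    forall c, ~ O c -> ~ G (sc O) (phi c) y}.
  apply/cid; have /choice[sc scP] : forall O, exists n, W O ->
      (exists2 a, O a & G n (phi a) y) /\ forall c, ~ O c -> ~ G n (phi c) y.
    move=> O; have [/Wy[n nP]|nWO] := pselect (W O); first by exists n.
    by exists 0%N.
  by exists sc => O WO; apply: scP.
(* The finest scale, that is the largest index. *)
have [X1 WX1 X1max] := finite_set_max sc finW (ex_intro _ _ WO0).
have [[a X1a ay] _] := scP _ WX1.
exists a => O WO; apply: contrapT => nOa.
by have [_ /(_ _ nOa)] := scP _ WO; apply; apply: Gle ay; exact: X1max.
Qed.

(** Swell a cover of the subspace, add the complement of the subspace, refine in
    the whole space, and restrict: a set is the trace of the swollen one. *)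
Lemma dim_le_closed n : closed (range phi) -> dim_le V n -> dim_le B n.
Proof.
have [phic phiO] := phiE => clB dV U [finU oU covU].
have [|W [[finW oW covW] WU ordW]] := dV ([set ~` range phi] `|` swell @` U).
  split.
  - by rewrite finite_setU; split=> //; exact: finite_image.
  - by move=> _ [->|[Q _ <-]]; [exact: closed_openC|exact: open_swell].
  - apply/seteqP; split=> // y _.
    have [[b _ <-]|ny] := pselect (range phi y); last first.
      by exists (~` range phi) => //; left.
    have [Q UQ Qb] : (\bigcup_(A in U) A) b by rewrite covU.
    exists (swell Q); first by right; exists Q.
    by have := preimage_swell (oU _ UQ) => /seteqP[_]; apply.
exists [set Y | (preimage phi @` W) Y /\ exists2 A, U A & Y `<=` A]; split.
- split.
  + by apply: (sub_finite_set _ (finite_image (preimage phi) finW)) => Y [].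
  + move=> _ [[Y /oW oY <-] _]; exact: (continuousP _).1.
  + apply/seteqP; split=> // b _.
    have [Y WY Yb] : (\bigcup_(A in W) A) (phi b) by rewrite covW.
    exists (phi @^-1` Y) => //; split; first by exists Y.
    have [_ [->|[Q UQ <-]] YA] := WU _ WY; first by case: (YA _ Yb); exists b.
    by exists Q => //; rewrite -(preimage_swell (oU _ UQ)) => x /YA.
- by move=> Y [].
- move=> b; apply: card_le_trans (ordW (phi b)).
  apply: card_le_trans (card_image_le (preimage phi) _).
  by apply: subset_card_le => _ [[[Y WY <-] _] Yb]; exists Y.
Qed.

End entourages.

Section dimension_from_clopen.
Context (V : topologicalType) (G : nat -> V -> V -> Prop).
Hypotheses (GV : entourage_base G) (Vcompact : compact [set: V]).

Definition clopen_separated (A : set V) :=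
  forall y, ~ A y -> exists D, [/\ clopen D, A `<=` D & ~ D y].

Lemma clopen_separated_closed A : clopen_separated A -> closed A.
Proof.
move=> sA; rewrite closedE => y yA; apply: contrapT => /sA[D [[oD cD] AD nDy]].
apply: yA; apply: filterS (open_nbhs_nbhs (conj (closed_openC cD) nDy)).
by move=> z nDz /AD.
Qed.

Lemma clopen_separated_nbhs A N : clopen_separated A -> open N -> A `<=` N ->
  exists D, [/\ clopen D, A `<=` D & D `<=` N].
Proof.
move=> sA oN AN.
suff [D [cD AD nD]] :
    exists D, [/\ clopen D, A `<=` D & D `&` setT `<=` N].
  by exists D; split=> // y Dy; apply: nD.
apply: (@compact_ideal V setT
  (fun Y => exists D, [/\ clopen D, A `<=` D & D `&` Y `<=` N])) => //.
- by exists setT; split=> //; [split; [exact: openT|exact: closedT]|rewrite setI0].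
- move=> Y Y' [D [[oD cD] AD DN]] [D' [[oD' cD'] AD' DN']].
  exists (D `&` D'); split.
  + by split; [exact: openI|exact: closedI].
  + by rewrite subsetI; split.
  + by move=> x [[Dx D'x] [Yx|Yx]]; [apply: DN|apply: DN'].
- move=> Y Y' YY' [D [cD AD DN]]; exists D; split=> //.
  by move=> x [Dx /YY' Y'x]; apply: DN.
- move=> x _; have [Nx|nNx] := pselect (N x).
    exists N; first exact: open_nbhs_nbhs.
    by exists setT; split=> //; split; [exact: openT|exact: closedT].
  have [|D [[oD cD] AD nDx]] := sA x; first by move=> /AN.
  exists (~` D); first by apply: open_nbhs_nbhs; split=> //; exact: closed_openC.
  by exists D; split=> // z [].
Qed.

Variables (U : set (set V)) (n : nat).

Definition refined_on (D : set V) :=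
  exists W : set (set V), [/\ [/\ finite_set W, W `<=` open & refines W U],
    \bigcup_(A in W) A = D &
    forall x, ([set Y | W Y /\ Y x] #<= `I_n.+1)%card].

Lemma refined_onI D E : refined_on D -> open E -> refined_on (D `&` E).
Proof.
move=> [W [[fW oW WU] covW ordW]] oE.
exists ((fun Y => Y `&` E) @` W); split.
- split; first exact: finite_image.
  + by move=> _ [Y /oW oY <-]; exact: openI.
  + by move=> _ [Y /WU[A UA YA] <-]; exists A => // x [/YA].
- rewrite -covW; apply/seteqP; split=> [x [_ [Y WY <-] [Yx Ex]]|x [[Y WY Yx] Ex]].
    by split=> //; exists Y.
  by exists (Y `&` E) => //; exists Y.
- move=> x; apply: card_le_trans (ordW x).
  apply: card_le_trans (card_image_le (fun Y => Y `&` E) _).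
  by apply: subset_card_le => _ [[Y WY <-] [Yx _]]; exists Y.
Qed.

Lemma refined_onU D E : D `&` E = set0 -> refined_on D -> refined_on E ->
  refined_on (D `|` E).
Proof.
move=> DE [W [[fW oW WU] covW ordW]] [W' [[fW' oW' WU'] covW' ordW']].
exists (W `|` W'); split.
- split; first by rewrite finite_setU.
  + by move=> Y [/oW|/oW'].
  + by move=> Y [/WU|/WU'].
- by rewrite bigcup_setU covW covW'.
- move=> x.
  have out (X X' : set (set V)) : (\bigcup_(A in X) A) x ->
      (\bigcup_(A in X) A) `&` (\bigcup_(A in X') A) = set0 ->
      forall Y, X' Y -> ~ Y x.
    by move=> Xx XX' Y X'Y Yx; rewrite -[False]/(set0 x) -XX'; split=> //; exists Y.
  have [Dx|nDx] := pselect (D x).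
    apply: card_le_trans (ordW x); apply: subset_card_le => Y [[WY|WY] Yx] //.
    by have := out W W'; rewrite covW covW' => /(_ Dx DE _ WY).
  apply: card_le_trans (ordW' x); apply: subset_card_le => Y [[WY|WY] Yx] //.
  by case: nDx; rewrite -covW; exists Y.
Qed.

Lemma refined_on_swell (B : topologicalType) (phi : B -> V) :
  finite_open_cover U -> entourage_embedding G phi -> dim_le B n ->
  exists2 N, open N & range phi `<=` N /\ refined_on N.
Proof.
move=> [finU oU covU] phiE dB; have [phic _] := phiE.
have [|W [[finW oW covW] WU ordW]] := dB (preimage phi @` U).
  split; first exact: finite_image.
  - move=> _ [A /oU oA <-]; exact: (continuousP _).1.
  - apply/seteqP; split=> // b _.
    have [A UA Ab] : (\bigcup_(A in U) A) (phi b) by rewrite covU.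
    by exists (phi @^-1` A) => //; exists A.
have /choice[u uP] : forall O, exists A, W O -> U A /\ O `<=` phi @^-1` A.
  move=> O; have [/WU[_ [A UA <-] OA]|nWO] := pselect (W O).
    by exists A.
  by exists set0.
pose h O := swell G phi O `&` u O.
have oh O : W O -> open (h O).
  by move=> WO; apply: openI; [exact: open_swell|apply: oU; case: (uP _ WO)].
exists (\bigcup_(A in h @` W) A).
  by apply: bigcup_open => _ [Q WQ <-]; exact: oh.
split.
  move=> _ [b _ <-]; have [Q WQ Qb] : (\bigcup_(A in W) A) b by rewrite covW.
  exists (h Q); first by exists Q.
  split; last by have [_] := uP _ WQ; apply.
  by have /seteqP[_] := preimage_swell GV phiE (oW _ WQ); apply.
exists (h @` W); split=> //.
- split; first exact: finite_image.
  + by move=> _ [Q WQ <-]; exact: oh.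
  + by move=> _ [Q WQ <-]; exists (u Q); [case: (uP _ WQ)|move=> x []].
- move=> y; pose Wy := [set O | W O /\ h O y].
  apply: (@card_le_trans _ _ _ Wy).
    apply: card_le_trans (card_image_le h _).
    by apply: subset_card_le => _ [[Q WQ <-] hy]; exists Q.
  have [->|/set0P Wy0] := eqVneq Wy set0; first exact: card_ge0.
  have [||a aWy] := @swell_inter V G GV B phi Wy y _ Wy0.
  + by apply: (sub_finite_set _ finW) => Q [].
  + by move=> O [_ []].
  apply: card_le_trans (ordW a); apply: subset_card_le => O OW.
  by split; [case: OW|exact: aWy].
Qed.

End dimension_from_clopen.

Lemma dim_le_subsingleton (B : topologicalType) n :
  (forall x y : B, x = y) -> dim_le B n.
Proof.
move=> B1 U [finU oU covU].
have [[b _]|B0] := pselect ([set: B] !=set0); last first.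
  exists U; split=> // [Y UY|x]; first by exists Y.
  by case: B0; exists x.
have [A UA Ab] : (\bigcup_(A in U) A) b by rewrite covU.
exists [set A]; split.
- split; [exact: finite_set1|by move=> _ ->; exact: oU|].
  by apply/seteqP; split=> // x _; exists A => //; rewrite (B1 x b).
- by move=> _ ->; exists A.
- move=> x; apply: card_le_trans (card_image_le (fun=> A) `I_n.+1).
  by apply: subset_card_le => _ [-> _]; exists 0%N.
Qed.

(** Each of the closed sets has a clopen neighborhood on which a given cover has
    a refinement of the required order: swell a refinement on the closed set.
    Finitely many such neighborhoods cover [V], and clopen sets can be made
    disjoint, so that the orders of the refinements do not add up. *)
Lemma dim_le_clopen_separated (V : topologicalType) (G : nat -> V -> V -> Prop)
    (n : nat) : entourage_base G -> compact [set: V] ->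
  (forall y : V, exists (B : topologicalType) (phi : B -> V),
    [/\ entourage_embedding G phi, dim_le B n, range phi y &
        clopen_separated (range phi)]) -> dim_le V n.
Proof.
move=> GV cV pieces U Ucov.
suff [D TD [_ [W [[fW oW WU] covW ordW]]]] : exists2 D, [set: V] `<=` D &
    clopen D /\ refined_on U n D.
  exists W; split=> //; split=> //; rewrite covW.
  by apply/seteqP.
have clopen0 : clopen (@set0 V) by split; [exact: open0|exact: closed0].
apply: (@compact_ideal V setT (fun Y => exists2 D, Y `<=` D &
  clopen D /\ refined_on U n D)) => //.
- exists set0 => //; split=> //.
  exists set0; split.
  + by split=> // Y [].
  + by apply/seteqP; split=> // x [].
  + move=> x; rewrite (_ : [set Y | _] = set0) ?card_ge0//.
    by apply/seteqP; split=> // Y [].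
- move=> Y Y' [D YD [[oD cD] rD]] [D' YD' [[oD' cD'] rD']].
  exists (D `|` (D' `&` ~` D)).
    move=> x [/YD Dx|/YD' D'x]; first by left.
    by have [Dx|nDx] := pselect (D x); [left|right].
  split; last first.
    apply: refined_onU => //.
      by apply/seteqP; split=> // x [Dx [_]]; apply.
    by apply: refined_onI => //; exact: closed_openC.
  split; first by apply: openU => //; apply: openI => //; exact: closed_openC.
  by apply: closedU => //; apply: closedI => //; exact: open_closedC.
- by move=> Y Y' YY' [D Y'D rD]; exists D => // x /YY' /Y'D.
- move=> y _; have [B [phi [phiE dB phiy sphi]]] := pieces y.
  have [N oN [phiN rN]] := refined_on_swell GV Ucov phiE dB.
  have [D [cD phiD DN]] := clopen_separated_nbhs cV sphi oN phiN.
  exists D; first by apply: open_nbhs_nbhs; split; [case: cD|exact: phiD].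
  exists D => //; split=> //.
  by rewrite -(setIidr DN); apply: refined_onI => //; case: cD.
Qed.

(** * Fellow travelling *)

Section fellow_travelling.
Context (R : realType) (X : metricType R) (g : bicombing X).
Implicit Types (e x y z : X) (t s M : R).

(** The coarse meaning of [(x | y)_e >= t], with the distance allowed between
    the two geodesics as a parameter. *)
Definition fellow e M t x y :=
  [/\ t <= mdist e x, t <= mdist e y &
      mdist (arclength_geod g e x t) (arclength_geod g e y t) <= M].

Lemma fellow_sym e M t x y : fellow e M t x y -> fellow e M t y x.
Proof. by case=> tx ty d; split=> //; rewrite metric_sym. Qed.

Lemma fellow_trans e M M' t x y z :
  fellow e M t x y -> fellow e M' t y z -> fellow e (M + M') t x z.
Proof.
case=> tx ty d [_ tz d']; split=> //.
by apply: le_trans (metric_triangle _ (arclength_geod g e y t) _) _; exact: lerD.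
Qed.

Variables (E C : R).
Hypothesis gcc : geodesic_coarsely_convex E C g.

Let E1 : 1 <= E. Proof. by case: gcc. Qed.
Let C0 : 0 <= C. Proof. by case: gcc. Qed.
Let gg : geodesic_bicombing g. Proof. by case: gcc. Qed.

Lemma mulVr_itv t s : 0 <= t <= s -> 0 <= t / s <= 1.
Proof.
move=> /andP[t0 ts]; have [s0|s0] := eqVneq s 0.
  by rewrite s0 invr0 mulr0 lexx ler01.
have sp : 0 < s by rewrite lt_neqAle eq_sym s0 (le_trans t0).
by rewrite divr_ge0 ?(ltW sp)//= ler_pdivrMr// mul1r.
Qed.

Lemma arclengthE e x t : 0 <= t <= mdist e x ->
  arclength_geod g e x t = g e x (t / mdist e x).
Proof.
move=> /andP[t0 tx]; rewrite /arclength_geod tx andbT.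
case: eqVneq => [<-|//] /=; rewrite mdistxx invr0 mulr0.
by have [-> _ _] := gg e e.
Qed.

Lemma arclength_dist e x s t : 0 <= s <= mdist e x -> 0 <= t <= mdist e x ->
  mdist (arclength_geod g e x s) (arclength_geod g e x t) = `|s - t|.
Proof.
move=> sx tx; rewrite !arclengthE//.
have [_ _ ->] := gg e x; [|exact: mulVr_itv|exact: mulVr_itv].
have [d0|d0] := eqVneq (mdist e x) 0.
  have -> : s = 0 by apply/eqP; rewrite eq_le andbC; move: sx; rewrite d0.
  have -> : t = 0 by apply/eqP; rewrite eq_le andbC; move: tx; rewrite d0.
  by rewrite d0 mulr0 subr0 normr0.
rewrite -mulrBl normrM normfV [`|mdist e x|]ger0_norm ?mdist_ge0//.
by rewrite mulfVK.
Qed.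

Lemma arclength0 e x : arclength_geod g e x 0 = e.
Proof.
rewrite arclengthE ?lexx ?mdist_ge0// mul0r.
by have [-> _ _] := gg e x.
Qed.

Lemma arclength_end e x t : mdist e x <= t -> arclength_geod g e x t = x.
Proof.
move=> xt; rewrite /arclength_geod; case: ifP => // /andP[ex tx].
have -> : t = mdist e x by apply/eqP; rewrite eq_le tx.
rewrite divff; first by have [_ -> _] := gg e x.
by apply: contra ex => /eqP/mdist_positivity ->.
Qed.

Lemma arclength_distl e x t : 0 <= t <= mdist e x ->
  mdist e (arclength_geod g e x t) = t.
Proof.
move=> tx; rewrite -{1}(arclength0 e x) arclength_dist ?lexx ?mdist_ge0//.
by rewrite sub0r normrN ger0_norm//; case/andP: tx.
Qed.

Lemma arclength_distr e x t : 0 <= t <= mdist e x ->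
  mdist (arclength_geod g e x t) x = mdist e x - t.
Proof.
move=> tx; rewrite -{2}(@arclength_end e x (mdist e x))//.
rewrite arclength_dist ?lexx ?mdist_ge0// distrC ger0_norm// subr_ge0.
by case/andP: tx.
Qed.

Lemma convex_arclength e x y c t : 0 <= c <= 1 -> 0 <= t ->
  t <= mdist e x -> t <= mdist e y ->
  mdist (arclength_geod g e x (c * t)) (arclength_geod g e y (c * t)) <=
    c * E * mdist (arclength_geod g e x t) (arclength_geod g e y t) + C.
Proof.
move=> c01 t0 tx ty; have [_ _ _ conv] := gcc.
have ct : 0 <= c * t <= t.
  by case/andP: c01 => c0 c1; rewrite mulr_ge0//= ler_piMl.
have le z : t <= mdist e z -> 0 <= c * t <= mdist e z.
  by move=> tz; case/andP: ct => -> /le_trans ->.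
rewrite !arclengthE ?t0 ?le// -!mulrA.
have := conv e e x y (t / mdist e x) (t / mdist e y) c.
rewrite mdistxx mulr0 add0r -!mulrA; apply=> //.
  by apply: mulVr_itv; rewrite t0.
by apply: mulVr_itv; rewrite t0.
Qed.

Lemma fellow_shrink e M t s x y : 0 <= s <= t -> fellow e M t x y ->
  fellow e (E * M + C) s x y.
Proof.
move=> /andP[s0 st] [tx ty d].
have E0 : 0 <= E by exact: le_trans ler01 E1.
have M0 : 0 <= M by exact: le_trans (mdist_ge0 _ _) d.
split; [exact: le_trans tx|exact: le_trans ty|].
have [t0|t0] := eqVneq t 0.
  have -> : s = 0 by apply/eqP; rewrite eq_le s0 -t0 st.
  by rewrite !arclength0 mdistxx addr_ge0// mulr_ge0.
have c01 : 0 <= s / t <= 1 by apply: mulVr_itv; rewrite s0.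
have := convex_arclength c01 (le_trans s0 st) tx ty.
rewrite divfK// => /le_trans; apply.
rewrite lerD2r; case/andP: c01 => c0 c1; rewrite -mulrA.
apply: le_trans (_ : s / t * (E * M) <= _).
  by rewrite ler_wpM2l// ler_wpM2l.
by rewrite ler_piMl// mulr_ge0.
Qed.

(** Whatever the distance [M] reached at time [t], it was at most [E + C] at a
    time comparable to [t].  As [E + C <= D_1], the Gromov product thus does not
    depend on its constant, up to a factor. *)
Lemma fellow_fraction e M l t x y : 0 <= t -> 1 <= l -> M <= l ->
  fellow e M t x y -> fellow e (E + C) (t / l) x y.
Proof.
move=> t0 l1 Ml [tx ty d].
have E0 : 0 <= E by exact: le_trans ler01 E1.
have l0 : 0 < l by exact: lt_le_trans l1.
have tl : t / l <= t by rewrite ler_pdivrMr// ler_peMr.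
split; [exact: le_trans tx|exact: le_trans ty|].
have c01 : 0 <= l^-1 <= 1 by rewrite invr_ge0 (ltW l0) invf_le1.
have := convex_arclength c01 t0 tx ty; rewrite (mulrC _ t) => /le_trans; apply.
rewrite lerD2r (mulrC _ E) -mulrA ler_piMr// mulrC ler_pdivrMr// mul1r.
exact: le_trans Ml.
Qed.

(** Coarse convexity compares the two geodesics at equal fractions of their
    lengths; the lengths differ by at most [mdist e1 e2], hence the additional
    summand at equal times. *)
Lemma arclength_basepoint e1 e2 x s :
  0 <= s <= mdist e1 x -> 0 <= s <= mdist e2 x ->
  mdist (arclength_geod g e1 x s) (arclength_geod g e2 x s) <=
    (E + 1) * mdist e1 e2 + C.
Proof.
move=> s1 s2; have [_ _ _ conv] := gcc.
have E0 : 0 <= E by exact: le_trans ler01 E1.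
set d := mdist e1 e2; have d0 : 0 <= d by exact: mdist_ge0.
have dd : `|mdist e2 x - mdist e1 x| <= d.
  rewrite ler_norml; apply/andP; split.
    by have := metric_triangle e1 e2 x; rewrite -/d; lra.
  by have := metric_triangle e2 e1 x; rewrite (metric_sym e2 e1) -/d; lra.
rewrite !arclengthE//; set c := s / mdist e1 x.
have c01 : 0 <= c <= 1 by exact: mulVr_itv.
have h1 : mdist (g e1 x c) (g e2 x c) <= E * d + C.
  have := conv e1 e2 x x 1 1 c; rewrite !mulr1.
  have [_ -> _] := gg e1 x; have [_ -> _] := gg e2 x.
  rewrite mdistxx mulr0 addr0 => h.
  apply: le_trans (h _ _ _) _ => //; try by rewrite ler01 lexx.
  rewrite lerD2r -mulrA ler_piMl ?mulr_ge0//.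
  by case/andP: c01 => ? ?; lra.
have h2 : mdist (g e2 x c) (g e2 x (s / mdist e2 x)) <= d.
  have [_ _ ->//] := gg e2 x; last exact: mulVr_itv.
  have [d1|d1] := eqVneq (mdist e1 x) 0.
    have s00 : s = 0 by apply/eqP; rewrite eq_le andbC; move: s1; rewrite d1.
    by rewrite /c s00 !mul0r subr0 normr0 mul0r.
  have [d2|d2] := eqVneq (mdist e2 x) 0; first by rewrite d2 mulr0.
  have -> : `|c - s / mdist e2 x| * mdist e2 x = c * `|mdist e2 x - mdist e1 x|.
    rewrite -{2}[mdist e2 x]ger0_norm ?mdist_ge0// -normrM mulrBl divfK//.
    rewrite -{2}[c]ger0_norm; last by case/andP: c01.
    by rewrite -normrM mulrBr /c divfK.
  apply: le_trans dd; rewrite ler_piMl//.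
  by case/andP: c01.
have := metric_triangle (g e1 x c) (g e2 x c) (g e2 x (s / mdist e2 x)).
lra.
Qed.

Lemma fellow_basepoint e1 e2 M t x y : mdist e1 e2 <= t ->
  fellow e1 M t x y ->
  fellow e2 (E * M + C + 2 * ((E + 1) * mdist e1 e2 + C)) (t - mdist e1 e2) x y.
Proof.
set d := mdist e1 e2 => dt f; have d0 : 0 <= d by exact: mdist_ge0.
have st : 0 <= t - d <= t by apply/andP; split; lra.
have [tx ty _] := f; have [sx sy h] := fellow_shrink st f.
have xd z : t <= mdist e1 z -> t - d <= mdist e2 z.
  by have := metric_triangle e1 e2 z; rewrite -/d; lra.
have s0 : 0 <= t - d by case/andP: st.
split; [exact: xd|exact: xd|].
have bx := @arclength_basepoint e1 e2 x (t - d).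
have by_ := @arclength_basepoint e1 e2 y (t - d).
rewrite s0 sx (xd x tx) -/d in bx; rewrite s0 sy (xd y ty) -/d in by_.
move: bx by_ => /(_ isT isT) bx /(_ isT isT) by_.
have := metric_triangle (arclength_geod g e2 x (t - d))
  (arclength_geod g e1 x (t - d)) (arclength_geod g e2 y (t - d)).
have := metric_triangle (arclength_geod g e1 x (t - d))
  (arclength_geod g e1 y (t - d)) (arclength_geod g e2 y (t - d)).
rewrite (metric_sym (arclength_geod g e2 x _) (arclength_geod g e1 x _)).
lra.
Qed.

(** The distance up to which geodesics stay when their product exceeds a time:
    [2 D_1] at a possibly later time, by coarse convexity before. *)
Definition cst_D2 := E * (2 * cst_D1 E C) + C.

Lemma cst_D1_ge : E + C <= cst_D1 E C.
Proof. by rewrite /cst_D1 /cst_D; have := E1; have := C0; lra. Qed.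

Lemma cst_D1_ge0 : 0 <= cst_D1 E C.
Proof. by apply: le_trans cst_D1_ge; have := E1; have := C0; lra. Qed.

Lemma cst_D2_ge0 : 0 <= cst_D2.
Proof.
rewrite /cst_D2 addr_ge0// mulr_ge0//; first exact: le_trans E1.
by rewrite mulr_ge0// cst_D1_ge0.
Qed.

(** A time realizing the supremum may exceed the length of the shorter
    geodesic.  In that case the other one moves by at most [D_1] from the end of
    the shorter to that time, by comparison of distances to [e]. *)
Lemma fellow_gromov_prod e t x y : 0 <= t ->
  (t%:E < gromov_prod e g E C x y)%E -> fellow e cst_D2 t x y.
Proof.
move=> t0; rewrite /gromov_prod !lt_min !lte_fin => /and3P[tx ty].
move=> /ereal_sup_gt[_ [t' [t'0 d'] <-]]; rewrite lte_fin => tt'.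
wlog xy : x y tx ty d' / mdist e x <= mdist e y.
  move=> wl; have [xy|yx] := leP (mdist e x) (mdist e y); first exact: wl.
  by apply: fellow_sym; apply: wl => //; [rewrite metric_sym|exact: ltW].
have D1 := cst_D1_ge0.
have [t'x|xt'] := leP t' (mdist e x).
  apply: (@fellow_shrink _ _ t'); first by rewrite t0 ltW.
  by split=> //; [exact: le_trans xy|apply: le_trans d' _; lra].
apply: (@fellow_shrink _ _ (mdist e x)); first by rewrite t0 ltW.
split=> //; rewrite (arclength_end (lexx _)).
rewrite (arclength_end (ltW xt')) in d'.
set z := arclength_geod g e y t' in d'.
have dx0 : 0 <= mdist e x by exact: mdist_ge0.
have [t'y|yt'] := leP t' (mdist e y).
  have ez : mdist e z = t' by rewrite arclength_distl// t'0.
  have h : mdist z (arclength_geod g e y (mdist e x)) = t' - mdist e x.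
    by rewrite arclength_dist ?t'0 ?dx0// ger0_norm// subr_ge0 ltW.
  have := metric_triangle x z (arclength_geod g e y (mdist e x)).
  have := metric_triangle e x z.
  by lra.
have zy : z = y by rewrite /z arclength_end ?ltW.
rewrite zy in d'.
have h : mdist y (arclength_geod g e y (mdist e x)) = mdist e y - mdist e x.
  by rewrite metric_sym arclength_distr ?dx0.
have := metric_triangle x y (arclength_geod g e y (mdist e x)).
have := metric_triangle e x y.
lra.
Qed.

Lemma gromov_prod_fellow e M l t x y : 0 <= t -> 1 <= l -> M <= l ->
  fellow e M t x y -> ((t / l)%:E <= gromov_prod e g E C x y)%E.
Proof.
move=> t0 l1 Ml /(fellow_fraction t0 l1 Ml)[tx ty d].
rewrite /gromov_prod !le_min !lee_fin tx ty /=.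
apply: ereal_sup_ubound; exists (t / l) => //; split; last first.
  exact: le_trans d cst_D1_ge.
by rewrite divr_ge0// (le_trans ler01).
Qed.

Lemma fellow_refl e t x : t <= mdist e x -> fellow e 0 t x x.
Proof. by move=> tx; split=> //; rewrite mdistxx. Qed.

End fellow_travelling.

(** * The ideal boundary in terms of fellow travelling *)

Lemma limn_einf_gt (R : realType) (u : nat -> \bar R) (x : \bar R) :
  (x < limn_einf u)%E -> \forall i \near \oo, (x < u i)%E.
Proof.
rewrite /limn_einf /limn_esup /limf_esup lteNr => /ereal_inf_lt[_ [A FA <-] supA].
apply: filterS FA => i Ai; rewrite -lteN2.
by apply: le_lt_trans supA; apply: ereal_sup_ubound; exists i.
Qed.

Lemma limn_einf_ge (R : realType) (u : nat -> \bar R) (x : \bar R) :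
  (\forall i \near \oo, (x <= u i)%E) -> (x <= limn_einf u)%E.
Proof.
move=> xu; rewrite /limn_einf /limn_esup /limf_esup leeNr.
apply: (@le_trans _ _ (ereal_sup [set (- u i)%E | i in [set i | (x <= u i)%E]])).
  by apply: ereal_inf_lbound; exists [set i | (x <= u i)%E].
by apply: ge_ereal_sup => _ [i /= xi <-]; rewrite leeN2.
Qed.

(** The lower limits of the extended product matter only up to a factor, so
    that limits of products are replaced below by fellow travelling of the terms
    of large index, for a bound on distances that is uniform in time. *)
Section sequences.
Context (R : realType) (X : metricType R) (g : bicombing X).
Implicit Types (e : X) (u v w : nat -> X).

Definition going_to_infinity e u :=
  exists M : R, forall t, 0 <= t -> exists N : nat, forall i j : nat,
    (N <= i)%N -> (N <= j)%N -> fellow g e M t (u i) (u j).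

Definition asymptotic e u v :=
  exists M : R, forall t, 0 <= t -> exists N : nat, forall i : nat,
    (N <= i)%N -> fellow g e M t (u i) (v i).

Lemma asymptotic_refl e u : going_to_infinity e u -> asymptotic e u u.
Proof.
move=> [M uM]; exists M => t t0; have [N uN] := uM t t0; exists N => i Ni.
exact: uN.
Qed.

Lemma asymptotic_sym e u v : asymptotic e u v -> asymptotic e v u.
Proof.
move=> [M uM]; exists M => t t0; have [N uN] := uM t t0; exists N => i Ni.
exact/fellow_sym/uN.
Qed.

Lemma asymptotic_trans e u v w :
  asymptotic e u v -> asymptotic e v w -> asymptotic e u w.
Proof.
move=> [M uM] [M' vM]; exists (M + M') => t t0.
have [N uN] := uM t t0; have [N' vN] := vM t t0; exists (maxn N N') => i.
by rewrite geq_max => /andP[Ni N'i]; apply: fellow_trans (uN _ Ni) (vN _ N'i).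
Qed.

Lemma asymptotic_infinity e u v :
  asymptotic e u v -> going_to_infinity e u -> going_to_infinity e v.
Proof.
move=> [M uM] [M' vM]; exists (M + M' + M) => t t0.
have [N uN] := uM t t0; have [N' vN] := vM t t0; exists (maxn N N') => i j.
rewrite !geq_max => /andP[Ni N'i] /andP[Nj N'j].
apply: fellow_trans (uN _ Nj); apply: fellow_trans (vN _ _ N'i N'j).
exact/fellow_sym/uN.
Qed.

Lemma infinity_unbounded e u : going_to_infinity e u ->
  forall r, exists N : nat, forall i : nat, (N <= i)%N -> r <= mdist e (u i).
Proof.
move=> [M uM] r; have [|N uN] := uM (Num.max 0 r); first by rewrite le_max lexx.
exists N => i Ni; have [+ _ _] := uN _ _ Ni Ni; apply: le_trans.
by rewrite le_max lexx orbT.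
Qed.

End sequences.

Section boundary.
Context (R : realType) (X : metricType R) (g : bicombing X) (E C : R) (e : X).
Hypothesis gcc : geodesic_coarsely_convex E C g.

Let D2 : R := cst_D2 E C.
Local Notation V := (ideal_boundary e g E C).
Local Notation prod := (gromov_prod e g E C).
Implicit Types (u v w : nat -> X) (a b c : V).

Lemma fellow_gromov_prod_ge M (A : R) x y :
  fellow g e M (Num.max 0 A * Num.max 1 M) x y -> (A%:E <= prod x y)%E.
Proof.
move=> f; have l1 : 1 <= Num.max 1 M by rewrite le_max lexx.
have l0 : 0 < Num.max 1 M by apply: lt_le_trans l1.
have A0 : 0 <= Num.max 0 A by rewrite le_max lexx.
have := gromov_prod_fellow gcc _ l1 _ f.
rewrite mulfK ?gt_eqF// => /(_ _ _)/(le_trans _); apply.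
- by rewrite lee_fin le_max lexx orbT.
- by rewrite mulr_ge0// ltW.
- by rewrite le_max lexx orbT.
Qed.

Lemma S_infty_fellow u : S_infty e g E C u -> forall t, 0 <= t ->
  exists N : nat, forall i j : nat, (N <= i)%N -> (N <= j)%N ->
    fellow g e D2 t (u i) (u j).
Proof.
move=> /cvgeyPgt uS t t0; have [[P Q] /= [[N _ NP] [N' _ NQ]] PQ] := uS t.
exists (maxn N N') => i j; rewrite !geq_max => /andP[Ni _] /andP[_ Nj].
apply: (fellow_gromov_prod gcc) => //; apply: (PQ (i, j)).
by split; [exact: NP|exact: NQ].
Qed.

Lemma S_inftyP u : S_infty e g E C u <-> going_to_infinity g e u.
Proof.
split=> [/S_infty_fellow uS|[M uM]]; first by exists D2.
apply/cvgeyPge => A.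
have [|N uN] := uM (Num.max 0 A * Num.max 1 M).
  by rewrite mulr_ge0// le_max ?lexx ?ler01.
exists ([set i | (N <= i)%N], [set i | (N <= i)%N]).
  by split; exists N.
by move=> [i j] [/= Ni Nj]; apply: fellow_gromov_prod_ge (uN _ _ Ni Nj).
Qed.

Lemma S_infty_equiv_fellow u v : S_infty_equiv e g E C u v ->
  forall t, 0 <= t -> exists N : nat, forall i : nat, (N <= i)%N ->
    fellow g e D2 t (u i) (v i).
Proof.
move=> /cvgeyPgt uS t t0; have [N _ NP] := uS t.
by exists N => i Ni; apply: (fellow_gromov_prod gcc) => //; exact: NP.
Qed.

Lemma S_infty_equivP u v : S_infty_equiv e g E C u v <-> asymptotic g e u v.
Proof.
split=> [/S_infty_equiv_fellow uS|[M uM]]; first by exists D2.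
apply/cvgeyPge => A.
have [|N uN] := uM (Num.max 0 A * Num.max 1 M).
  by rewrite mulr_ge0// le_max ?lexx ?ler01.
exists N => // i Ni; exact: fellow_gromov_prod_ge (uN _ Ni).
Qed.

Lemma boundary_classP a : exists2 u, going_to_infinity g e u &
  set_val a = [set v | going_to_infinity g e v /\ asymptotic g e u v].
Proof.
have [u uS aE] := set_mem (valP a); exists u; first exact/S_inftyP.
apply: etrans aE _.
by apply/seteqP; split=> v [/S_inftyP ? /S_infty_equivP ?].
Qed.

Lemma boundary_reps a : exists u, set_val a u.
Proof.
have [u ui ->] := boundary_classP a; exists u; split=> //.
exact: asymptotic_refl.
Qed.

Lemma reps_infinity a u : set_val a u -> going_to_infinity g e u.
Proof. by have [v _ ->] := boundary_classP a; case. Qed.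

Lemma reps_asymptotic a u v : set_val a u -> set_val a v -> asymptotic g e u v.
Proof.
have [w _ ->] := boundary_classP a => -[_ wu] [_ wv].
exact: asymptotic_trans (asymptotic_sym wu) wv.
Qed.

Lemma asymptotic_reps a u v : set_val a u -> asymptotic g e u v -> set_val a v.
Proof.
have [w _ ->] := boundary_classP a => -[ui wu] uv.
by split; [exact: asymptotic_infinity uv ui|exact: asymptotic_trans wu uv].
Qed.

Lemma boundary_class u : going_to_infinity g e u -> exists a, set_val a u.
Proof.
move=> ui.
have h : [set c : set (nat -> X) | exists2 u, S_infty e g E C u &
    c = [set v | S_infty e g E C v /\ S_infty_equiv e g E C u v]]
    [set v | S_infty e g E C v /\ S_infty_equiv e g E C u v].
  by exists u => //; exact/S_inftyP.
exists (SigSub (mem_set h)); split; first exact/S_inftyP.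
exact/S_infty_equivP/asymptotic_refl.
Qed.

Lemma asymptotic_eq a b u v : set_val a u -> set_val b v ->
  asymptotic g e u v -> a = b.
Proof.
move=> au bv uv; apply: val_inj; apply/seteqP; split=> w.
  move=> /(reps_asymptotic au) uw; apply: asymptotic_reps bv _.
  exact: asymptotic_trans (asymptotic_sym uv) uw.
move=> /(reps_asymptotic bv) vw; apply: asymptotic_reps au _.
exact: asymptotic_trans uv vw.
Qed.

Lemma reps_fellow a u v : set_val a u -> set_val a v ->
  forall t, 0 <= t -> exists N : nat, forall i : nat, (N <= i)%N ->
    fellow g e D2 t (u i) (v i).
Proof.
by move=> au av; apply/S_infty_equiv_fellow/S_infty_equivP/(reps_asymptotic au av).
Qed.

Definition boundary_entourage (n : nat) a b : Prop :=
  (n%:R%:E < @ext_gromov_prod _ _ e g E C (inr a) (inr b))%E.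

Lemma boundary_entourage_fellow n a b : boundary_entourage n a b ->
  forall u v, set_val a u -> set_val b v ->
  exists N : nat, forall i : nat, (N <= i)%N ->
    fellow g e (D2 + D2 + D2) n%:R (u i) (v i).
Proof.
move=> /ereal_sup_gt[_ [[u' v'] /= [au' bv'] <-]] /limn_einf_gt[N _ NP] u v au bv.
have [N1 N1P] := reps_fellow au au' (ler0n R n).
have [N2 N2P] := reps_fellow bv' bv (ler0n R n).
exists (maxn N (maxn N1 N2)) => i; rewrite !geq_max => /and3P[Ni N1i N2i].
apply: fellow_trans (N2P _ N2i); apply: fellow_trans (N1P _ N1i) _.
by apply: (fellow_gromov_prod gcc); [exact: ler0n|exact: NP].
Qed.

Lemma fellow_boundary_entourage n a b u v (M l t : R) : 0 <= t ->
  1 <= l -> M <= l -> n%:R * l < t ->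
  set_val a u -> set_val b v ->
  (exists N : nat, forall i : nat, (N <= i)%N -> fellow g e M t (u i) (v i)) ->
  boundary_entourage n a b.
Proof.
move=> t0 l1 Ml nlt au bv [N NP].
have l0 : 0 < l by apply: lt_le_trans l1.
apply: (@lt_le_trans _ _ (t / l)%:E); first by rewrite lte_fin ltr_pdivlMr.
apply: le_trans (_ : _ <= limn_einf (fun i => prod (u i) (v i)))%E _; last first.
  by apply: ereal_sup_ubound; exists (u, v).
apply: limn_einf_ge; exists N => // i Ni.
exact: (gromov_prod_fellow gcc) (NP _ Ni).
Qed.

(** The boundary topology ignores the points of [X]: they are isolated from
    the boundary, the products with [x] being at most [mdist e x]. *)
Lemma boundary_openP (O : set V) :
  open O <-> forall a, O a -> exists n, forall b, boundary_entourage n a b -> O b.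
Proof.
split.
  move=> -[A oA <-] a Aa; have [n n0 nA] := oA _ Aa.
  by exists n => b ab; apply: nA; left.
move=> oO; exists ([set inl x | x in setT] `|` [set inr a | a in O]); last first.
  apply/seteqP; split=> [a [[x _ //]|[b Ob [<-]]] //|a Oa]; by right; exists a.
move=> _ [[x _ <-]|[a Oa <-]]; last first.
  have [n nO] := oO _ Oa; exists n.+1 => //.
  move=> [x _|b]; first by left; exists x.
  move=> [ab|[x [y []]] //]; right; exists b => //; apply: nO.
  by apply: le_lt_trans ab; rewrite lee_fin ler_nat.
have [n xn] : exists n : nat, mdist e x <= n.+1%:R.
  exists (Num.truncn (mdist e x)).
  by rewrite ltW// Num.Theory.truncnS_gt.
exists n.+1 => // -[y _|b]; first by left; exists y.
move=> [|[? [? []]] //]; rewrite /= ltNge => /negP[].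
apply: ge_ereal_sup => _ [[u v] /= [-> bv] <-].
rewrite leNgt; apply/negP => /limn_einf_gt[N _ NP].
have := NP N (leqnn N); rewrite /= ltNge => /negP[].
by rewrite /gromov_prod ge_min lee_fin xn.
Qed.

Let D2_ge0 : 0 <= D2 := cst_D2_ge0 gcc.

Lemma boundary_entourage_base : entourage_base boundary_entourage.
Proof.
split.
- move=> n a; have [u au] := boundary_reps a.
  set l : R := D2 + 1; have l1 : 1 <= l by rewrite /l lerDr.
  apply: (@fellow_boundary_entourage n a a u u D2 l (n%:R * l + 1)) => //.
  + by rewrite addr_ge0// mulr_ge0// (le_trans ler01).
  + by rewrite /l lerDl.
  + by rewrite ltrDl.
  + apply: (reps_fellow au au).
    by rewrite addr_ge0// mulr_ge0// (le_trans ler01).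
- by move=> m n a b mn; apply: le_lt_trans; rewrite lee_fin ler_nat.
- move=> n; set M := D2 + D2 + D2; set l : R := M + M + 1.
  have M0 : 0 <= M by have := D2_ge0; rewrite /M; lra.
  have l1 : 1 <= l by rewrite /l lerDr addr_ge0.
  have nl0 : 0 <= n%:R * l by rewrite mulr_ge0// (le_trans ler01).
  exists (Num.truncn (n%:R * l)).+1 => a b c ab cb.
  have [u au] := boundary_reps a; have [v bv] := boundary_reps b.
  have [w cw] := boundary_reps c.
  have [N1 h1] := boundary_entourage_fellow ab au bv.
  have [N2 h2] := boundary_entourage_fellow cb cw bv.
  apply: (@fellow_boundary_entourage n a c u w (M + M) l
    (Num.truncn (n%:R * l)).+1%:R) => //.
  + by rewrite /l lerDl.
  + by rewrite Num.Theory.truncnS_gt.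
  + exists (maxn N1 N2) => i; rewrite geq_max => /andP[N1i N2i].
    by apply: fellow_trans (h1 _ N1i) _; exact/fellow_sym/h2.
- exact: boundary_openP.
Qed.

End boundary.

(** * Compactness of the boundary of a proper space *)

Lemma entourage_compact (V : topologicalType) (G : nat -> V -> V -> Prop) :
  entourage_base G ->
  (forall (F : set_system V) n, UltraFilter F ->
    exists2 S, F S & forall a b, S a -> S b -> G n a b) ->
  (forall a_ : nat -> V,
    (forall n i j, (n <= i)%N -> (n <= j)%N -> G n (a_ i) (a_ j)) ->
    exists c, forall k, exists N, forall n, (N <= n)%N -> G k (a_ n) c) ->
  compact [set: V].
Proof.
move=> GV cauchy complete; have [Gxx Gle Gtr Gop] := GV.
rewrite compact_ultra => F FU _.
have /choice[S SP] : forall n, exists S, F S /\ forall a b, S a -> S b -> G n a b.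
  by move=> n; have [S FS SG] := cauchy F n FU; exists S.
pose I n := \bigcap_(i in `I_n.+1) S i.
have FI n : F (I n).
  rewrite /I; elim: n => [|n IH].
    apply: filterS (SP 0%N).1 => a Sa i /=; rewrite ltnS leqn0 => /eqP ->.
    exact: Sa.
  apply: filterS (filterI IH (SP n.+1).1) => a [Ia Sa] i /=.
  by rewrite ltnS leq_eqVlt => /orP[/eqP->//|/Ia].
have /choice[a_ aP] : forall n, exists a, I n a.
  by move=> n; apply: filter_ex (FI n).
have [|c cP] := complete a_.
  move=> n i j ni nj; have [_ SG] := SP n.
  by apply: SG; [exact: (aP i)|exact: (aP j)].
exists c; split=> // A; rewrite nbhsE => -[B [oB Bc] BA].
have [k kB] := (Gop _).1 oB _ Bc.
have [m1 m1P] := Gtr k; have [m2 m2P] := entourage_sym GV m1.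
have [N NP] := cP (maxn m1 m2).
apply: filterS (FI (maxn N (maxn m1 m2))) => b Ib.
apply: BA; apply: kB; apply: (m1P _ (a_ (maxn N (maxn m1 m2)))).
  apply: m2P; apply: Gle (NP _ _); first exact: leq_maxr.
  exact: leq_maxl.
have [_ SG] := SP m1; apply: SG.
  by apply: Ib; rewrite /= ltnS (leq_trans (leq_maxl _ m2))// leq_maxr.
by apply: aP; rewrite /= ltnS (leq_trans (leq_maxl _ m2))// leq_maxr.
Qed.

Section boundary_compact.
Context (R : realType) (X : metricType R) (g : bicombing X) (E C : R) (e : X).
Hypothesis gcc : geodesic_coarsely_convex E C g.

Local Notation V := (ideal_boundary e g E C).

Let D2 : R := cst_D2 E C.
Let E1 : 1 <= E. Proof. by case: gcc. Qed.
Let C0 : 0 <= C. Proof. by case: gcc. Qed.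

(** All geodesics to far points cross the sphere of radius [t], which is compact
    as the space is proper, and those crossing it in the same ball of radius 1
    fellow travel up to time [t]. *)
Lemma boundary_precompact (F : set_system V) n :
  proper_space X -> UltraFilter F ->
  exists2 S, F S & forall a b, S a -> S b -> boundary_entourage n a b.
Proof.
move=> prX FU; have D20 : 0 <= D2 := cst_D2_ge0 gcc.
set l : R := D2 + 2 + D2; have l1 : 1 <= l by rewrite /l; lra.
have l0 : 0 <= l by lra.
set t : R := n%:R * l + 1.
have t0 : 0 <= t by rewrite /t addr_ge0// mulr_ge0.
have /choice[u uP] : forall a : V, exists u, set_val a u.
  by move=> a; exact: (boundary_reps gcc).
have /choice[m mP] : forall a : V, exists N : nat, forall i j : nat,
    (N <= i)%N -> (N <= j)%N -> fellow g e D2 t (u a i) (u a j).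
  move=> a; apply: (S_infty_fellow gcc) => //.
  exact/(S_inftyP _ gcc)/(reps_infinity gcc (uP a)).
pose x a := arclength_geod g e (u a (m a)) t.
have ex a : mdist e (x a) = t.
  rewrite (arclength_distl gcc)// t0 /=.
  by have [] := mP a (m a) (m a) (leqnn _) (leqnn _).
have [z [_ zF]] : [set y | mdist e y <= t] `&` cluster (x @ F) !=set0.
  apply: (prX e t); rewrite /fmap/= (_ : _ @^-1` _ = setT); first exact: filterT.
  by apply/seteqP; split=> // a _ /=; rewrite ex.
exists [set a | mdist z (x a) < 1].
  have [//|FS] := in_ultra_setVsetC [set a | mdist z (x a) < 1] FU.
  have [] := zF [set y | ~ (mdist z y < 1)] (ball z 1).
  - by [].
  - exact: nbhsx_ballx.
  - by move=> y [] /= /[swap]; rewrite ballEmdist.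
move=> a b /= za zb.
apply: (@fellow_boundary_entourage _ _ _ _ _ _ gcc n a b (u a) (u b) l l t) => //.
  by rewrite /t ltrDl.
exists (maxn (m a) (m b)) => i; rewrite geq_max => /andP[ai bi].
apply: fellow_trans (mP b _ _ (leqnn _) bi).
apply: fellow_trans (mP a _ _ ai (leqnn _)) _.
have [ta _ _] := mP a _ _ (leqnn _) (leqnn _).
have [tb _ _] := mP b _ _ (leqnn _) (leqnn _).
split=> //; rewrite -/(x a) -/(x b).
have := metric_triangle (x a) z (x b); rewrite (metric_sym (x a) z); lra.
Qed.

(** A diagonal argument on representatives: the [n]-th term of the limit is a
    term of the [n]-th sequence past which that sequence no longer moves at
    time [n]. *)
Lemma boundary_complete (a_ : nat -> V) :
  (forall n i j, (n <= i)%N -> (n <= j)%N -> boundary_entourage n (a_ i) (a_ j)) ->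
  exists c, forall k, exists N, forall n, (N <= n)%N ->
    boundary_entourage k (a_ n) c.
Proof.
move=> aC; have D20 : 0 <= D2 := cst_D2_ge0 gcc.
have /choice[u uP] : forall n, exists u, set_val (a_ n) u.
  by move=> n; exact: (boundary_reps gcc).
have /choice[m mP] : forall n, exists N : nat, forall i j : nat,
    (N <= i)%N -> (N <= j)%N -> fellow g e D2 n%:R (u n i) (u n j).
  move=> n; apply: (S_infty_fellow gcc) => //.
  exact/(S_inftyP _ gcc)/(reps_infinity gcc (uP n)).
pose w n := u n (m n).
set M := D2 + (D2 + D2 + D2) + (E * D2 + C).
have M0 : 0 <= M.
  have : 0 <= E * D2 by rewrite mulr_ge0// (le_trans ler01 E1).
  by rewrite /M; have := C0; lra.
have wP n n' : (n <= n')%N -> fellow g e M n%:R (w n) (w n').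
  move=> nn'.
  have [N NP] := boundary_entourage_fellow gcc (aC n n n' (leqnn _) nn')
    (uP n) (uP n').
  set i := maxn N (maxn (m n) (m n')).
  have Ni : (N <= i)%N by rewrite leq_maxl.
  have mi : (m n <= i)%N by rewrite /i maxnCA leq_maxl.
  have m'i : (m n' <= i)%N by rewrite /i maxnA leq_maxr.
  apply: fellow_trans (fellow_trans (mP n _ _ (leqnn _) mi) (NP _ Ni)) _.
  apply: (fellow_shrink gcc) (mP n' _ _ m'i (leqnn _)).
  by rewrite ler0n ler_nat.
have winf : going_to_infinity g e w.
  exists (E * M + C) => t t0; exists (Num.truncn t).+1 => i j.
  wlog ij : i j / (i <= j)%N.
    move=> wl; have [ij|/ltnW ji] := leqP i j; first exact: wl.
    by move=> Ni Nj; apply: fellow_sym; exact: wl.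
  move=> Ni Nj; apply: (fellow_shrink gcc) (wP _ _ ij).
  rewrite t0 (le_trans (ltW (Num.Theory.truncnS_gt t)))// ler_nat.
  exact: Ni.
have [c cw] := boundary_class gcc winf; exists c => k.
set l : R := D2 + M + 1; have l1 : 1 <= l by rewrite /l; lra.
exists (Num.truncn (k%:R * l)).+1 => n Nn.
apply: (@fellow_boundary_entourage _ _ _ _ _ _ gcc k (a_ n) c (u n) w (D2 + M) l
  n%:R) => //.
- by rewrite /l lerDl.
- by rewrite (lt_le_trans (Num.Theory.truncnS_gt _))// ler_nat.
- exists (maxn n (m n)) => i; rewrite geq_max => /andP[ni mi].
  exact: fellow_trans (mP n _ _ mi (leqnn _)) (wP _ _ ni).
Qed.

Lemma boundary_compact : proper_space X -> compact [set: V].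
Proof.
move=> prX; apply: entourage_compact (boundary_entourage_base e gcc) _ _.
  by move=> F n; exact: boundary_precompact.
exact: boundary_complete.
Qed.

End boundary_compact.

(** * Cut points and clopen sets of the boundary *)

Section cut_sets.
Context (R : realType) (X : metricType R).

(** A metric substitute for: [S] is a union of components of the complement
    of [p]. *)
Definition cut_set (p : X) (S : set X) :=
  ~ S p /\ forall x y, S x -> ~ S y -> mdist x y = mdist x p + mdist p y.

Lemma cut_setC p S : cut_set p S -> cut_set p [set x | ~ S x /\ x <> p].
Proof.
move=> [nSp cS]; split=> [[_]//|x y [nSx xp] nSy].
have [Sy|nSy'] := pselect (S y).
  by rewrite metric_sym (cS _ _ Sy nSx) addrC metric_sym (metric_sym y).
have -> : y = p by apply: contrapT => yp; apply: nSy.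
by rewrite mdistxx addr0.
Qed.

Variables (g : bicombing X) (E C : R) (e : X).
Hypothesis gcc : geodesic_coarsely_convex E C g.

Lemma cut_set_dist p S x : cut_set p S -> ~ S e -> S x ->
  mdist e x = mdist e p + mdist p x.
Proof.
move=> [_ cS] nSe Sx.
by rewrite metric_sym (cS _ _ Sx nSe) addrC metric_sym (metric_sym x).
Qed.

(** The point at distance [mdist e p] from [e] cannot be in [S], and outside of
    [S] it lies on a shortest way from [e] to [p] to [x]. *)
Lemma arclength_cut_point p S x : cut_set p S -> ~ S e -> S x ->
  arclength_geod g e x (mdist e p) = p.
Proof.
move=> cS nSe Sx; have exE := cut_set_dist cS nSe Sx.
have px0 := mdist_ge0 p x.
have ep : 0 <= mdist e p <= mdist e x by rewrite mdist_ge0 exE lerDl.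
set z := arclength_geod _ _ _ _.
have ez : mdist e z = mdist e p by exact: (arclength_distl gcc).
have zx : mdist z x = mdist e x - mdist e p by exact: (arclength_distr gcc).
apply: mdist_positivity.
have zp0 := mdist_ge0 z p.
have [Sz|nSz] := pselect (S z).
  have := cut_set_dist cS nSe Sz; rewrite ez (metric_sym p z); lra.
have := cS.2 _ _ Sx nSz; rewrite (metric_sym x z) (metric_sym x p) (metric_sym p z).
lra.
Qed.

(** Past the cut point, a geodesic that crosses it and one that does not
    diverge at unit speed at least. *)
Lemma cut_set_fellow p S M t x y : cut_set p S -> 0 <= t -> S x -> ~ S y ->
  fellow g e M t x y -> t <= mdist e p + M.
Proof.
have outer (S' : set X) x' y' : cut_set p S' -> ~ S' e -> 0 <= t ->
    S' x' -> ~ S' y' -> fellow g e M t x' y' -> t <= mdist e p + M.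
  move=> cS nSe t0 Sx nSy [tx ty d]; have [nSp cS2] := cS.
  have [tp|pt] := leP t (mdist e p).
    by have := mdist_ge0 (arclength_geod g e x' t) (arclength_geod g e y' t); lra.
  have ezx : mdist e (arclength_geod g e x' t) = t.
    by rewrite (arclength_distl gcc)// t0.
  have zx : mdist (arclength_geod g e x' t) x' = mdist e x' - t.
    by rewrite (arclength_distr gcc)// t0.
  have ezy : mdist e (arclength_geod g e y' t) = t.
    by rewrite (arclength_distl gcc)// t0.
  have zy : mdist (arclength_geod g e y' t) y' = mdist e y' - t.
    by rewrite (arclength_distr gcc)// t0.
  move: ezx zx ezy zy d.
  set zx := arclength_geod g e x' t; set zy := arclength_geod g e y' t.
  move=> ezx zxx ezy zyy d.
  have ex := cut_set_dist cS nSe Sx.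
  have Szx : S' zx.
    apply: contrapT => nS; have := cS2 _ _ Sx nS.
    rewrite (metric_sym x' zx) (metric_sym x' p) zxx.
    by have := mdist_ge0 p zx; lra.
  have nSzy : ~ S' zy.
    move=> Szy; have := cS2 _ _ Szy nSy; have := cut_set_dist cS nSe Szy.
    rewrite ezy zyy (metric_sym zy p).
    have := metric_triangle e p y'; lra.
  have := cS2 _ _ Szx nSzy; have := cut_set_dist cS nSe Szx.
  rewrite ezx (metric_sym zx p); have := mdist_ge0 p zy; lra.
move=> cS t0 Sx nSy f; have [Se|nSe] := pselect (S e); last exact: (outer S x y).
have [yp|yp] := pselect (y = p).
  have [_ + dM] := f; rewrite yp => tp.
  by have := le_trans (mdist_ge0 _ _) dM; lra.
apply: (outer [set x | ~ S x /\ x <> p] y x (cut_setC cS)) => //.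
- by case.
- by case.
- exact: fellow_sym.
Qed.

Lemma fellow_cut_set p S M t x y : cut_set p S -> 0 <= t ->
  mdist e p + M < t -> fellow g e M t x y -> S x -> S y.
Proof.
move=> cS t0 tM f Sx; apply: contrapT => nSy.
by have := cut_set_fellow cS t0 Sx nSy f; lra.
Qed.

Local Notation V := (ideal_boundary e g E C).

Definition boundary_of (S : set X) : set V :=
  [set c | exists u, set_val c u /\
             exists N : nat, forall i : nat, (N <= i)%N -> S (u i)].

Section with_cut_point.
Variables (p : X) (S : set X).
Hypothesis cS : cut_set p S.

Lemma boundary_of_rep (c : V) u : boundary_of S c -> set_val c u ->
  exists N : nat, forall i : nat, (N <= i)%N -> S (u i).
Proof.
move=> [v [cv [N NP]]] cu; have D20 := cst_D2_ge0 gcc.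
have t0 : 0 <= mdist e p + cst_D2 E C + 1.
  by have := mdist_ge0 e p; lra.
have [N' N'P] := reps_fellow gcc cv cu t0.
exists (maxn N N') => i; rewrite geq_max => /andP[Ni N'i].
by apply: (fellow_cut_set cS t0 _ (N'P _ N'i)); [lra|exact: NP].
Qed.

Lemma not_boundary_of_rep (c : V) u : ~ boundary_of S c -> set_val c u ->
  exists N : nat, forall i : nat, (N <= i)%N -> ~ S (u i).
Proof.
move=> nSc cu; have D20 := cst_D2_ge0 gcc.
have t0 : 0 <= mdist e p + cst_D2 E C + 1.
  by have := mdist_ge0 e p; lra.
have [N NP] := S_infty_fellow gcc
  ((S_inftyP _ gcc u).2 (reps_infinity gcc cu)) t0.
exists N => i Ni Si; apply: nSc; exists u; split=> //; exists N => j Nj.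
by apply: (fellow_cut_set cS t0 _ (NP _ _ Ni Nj)) => //; lra.
Qed.

(** Two boundary points of which one only is in [boundary_of S] have a product
    bounded in terms of the distance from [e] to [p]. *)
Lemma clopen_boundary_of : clopen (boundary_of S).
Proof.
have D20 := cst_D2_ge0 gcc.
set M := cst_D2 E C + cst_D2 E C + cst_D2 E C.
set n := (Num.truncn (mdist e p + M)).+1.
have nM : mdist e p + M < n%:R by exact: Num.Theory.truncnS_gt.
split.
  apply/boundary_openP => c Sc; exists n => c' cc'.
  have [u cu] := boundary_reps gcc c; have [v cv] := boundary_reps gcc c'.
  have [N NP] := boundary_entourage_fellow gcc cc' cu cv.
  have [N' N'P] := boundary_of_rep Sc cu.
  exists v; split=> //; exists (maxn N N') => i.
  rewrite geq_max => /andP[Ni N'i].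
  by apply: (fellow_cut_set cS (ler0n R n) nM (NP _ Ni)); exact: N'P.
rewrite -openC; apply/boundary_openP => c nSc; exists n => c' cc' Sc'.
apply: nSc.
have [u cu] := boundary_reps gcc c; have [v cv] := boundary_reps gcc c'.
have [N NP] := boundary_entourage_fellow gcc cc' cu cv.
have [N' N'P] := boundary_of_rep Sc' cv.
exists u; split=> //; exists (maxn N N') => i.
rewrite geq_max => /andP[Ni N'i].
have f := fellow_sym (NP _ Ni).
by apply: (fellow_cut_set cS (ler0n R n) nM f); exact: N'P.
Qed.

End with_cut_point.

(** Geodesics to two points behind the same cut points pass through all of
    these; if they are arbitrarily far away, the two boundary points agree. *)
Lemma clopen_separated_end (c : V) :
  (forall r, exists p S, [/\ cut_set p S, ~ S e, boundary_of S c & r < mdist e p]) ->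
  clopen_separated [set c].
Proof.
move=> cutc c' c'c; apply: contrapT => nsep; apply: c'c.
have [u cu] := boundary_reps gcc c; have [v cv] := boundary_reps gcc c'.
apply/esym/(asymptotic_eq gcc cu cv); exists (E * 0 + C) => t t0.
have [p [S [cS nSe Sc tp]]] := cutc t.
have Sc' : boundary_of S c'.
  apply: contrapT => nSc'; apply: nsep; exists (boundary_of S); split=> //.
    exact: clopen_boundary_of cS.
  by move=> _ ->.
have [N NP] := boundary_of_rep cS Sc cu.
have [N' N'P] := boundary_of_rep cS Sc' cv.
exists (maxn N N') => i; rewrite geq_max => /andP[/NP Su /N'P Sv].
apply: (@fellow_shrink _ _ _ _ _ gcc e 0 (mdist e p)); first by rewrite t0 ltW.
split.
- by rewrite (cut_set_dist cS nSe Su) lerDl mdist_ge0.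
- by rewrite (cut_set_dist cS nSe Sv) lerDl mdist_ge0.
- by rewrite !(arclength_cut_point cS nSe)// mdistxx.
Qed.

End cut_sets.

(** * Deleting an edge from a tree *)

Section tree_sides.
Context (K L : choiceType) (adj : K -> L -> bool).
Implicit Types (k : K) (l : L) (u v : (K + L)%type).

Definition delete_edge k l : rel (K + L)%type := fun u v =>
  [&& bip_edge adj u v, ~~ ((u == inl k) && (v == inr l)) &
      ~~ ((u == inr l) && (v == inl k))].

Definition reachable (r : rel (K + L)%type) u v :=
  exists2 p, path r u p & last u p = v.

(** A half-tree.  Deleting the edge rather than the vertex [l] makes it the
    complement of the half-tree on the side of [l]. *)
Definition side k l v := reachable (delete_edge k l) (inl k) v.

Lemma bip_edge_sym : symmetric (bip_edge adj).
Proof. by move=> [k|l] [k'|l']. Qed.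

Lemma delete_edge_sym k l : symmetric (delete_edge k l).
Proof.
move=> u v; rewrite /delete_edge bip_edge_sym.
by congr (_ && _); rewrite andbC; congr (~~ _ && ~~ _); rewrite andbC.
Qed.

Lemma reachable_trans r u v w : reachable r u v -> reachable r v w -> reachable r u w.
Proof.
move=> [p rp <-] [q rq <-]; exists (p ++ q); last by rewrite last_cat.
by rewrite cat_path rp.
Qed.

Lemma reachable_sym r u v : symmetric r -> reachable r u v -> reachable r v u.
Proof.
move=> rs [p rp <-]; exists (rev (belast u p)).
  by rewrite rev_path; apply: sub_path rp => x y; rewrite rs.
case: p {rp} => //= x p; rewrite rev_cons last_rcons//.
Qed.

Lemma reachable1 (r : rel (K + L)%type) u v : r u v -> reachable r u v.
Proof. by move=> ruv; exists [:: v] => //=; rewrite ruv. Qed.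

Lemma side_closed k l u v : side k l u -> bip_edge adj u v -> v != inr l ->
  side k l v.
Proof.
move=> ku uv vl; have [->|vk] := eqVneq v (inl k); first by exists [::].
apply: reachable_trans ku (reachable1 _).
by rewrite /delete_edge uv (negbTE vl) (negbTE vk) !andbF.
Qed.

Lemma path_delete_edge k l u p w : path (bip_edge adj) u p ->
  w = inl k \/ w = inr l -> w \notin u :: p -> path (delete_edge k l) u p.
Proof.
move=> up wkl wp; apply: (@sub_in_path _ (fun x => x != w)) up.
  move=> x y xw yw xy; rewrite /delete_edge xy /=.
  by case: wkl xw yw => -> xw yw; rewrite ?(negbTE xw) ?(negbTE yw) ?andbF.
by apply/allP => x xp; apply: contra wp => /eqP <-.
Qed.

Hypothesis tree : bipartite_tree adj.

(** Otherwise the path would close up to a cycle through the deleted edge. *)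
Lemma side_bridge k l : adj k l -> ~ side k l (inr l).
Proof.
move=> kl [p kp]; have [_ _ acyclic] := tree.
case/shortenP: kp => p' kp' up' _ lastp'.
case: p' kp' up' lastp' => [//|x [|y q]] kp' up' lastp'.
  by move: kp' lastp'; rewrite /= andbT => /and3P[_ + _] xl; rewrite xl !eqxx.
suff cyc : cycle (bip_edge adj) [:: inl k, x, y & q] by have := acyclic _ cyc up'.
rewrite /cycle rcons_path lastp' /= kl andbT.
by apply: sub_path kp' => a b /and3P[].
Qed.

(** A common vertex would join [k'] to [k], and by way of [k] to [l], without the
    edge from [k'] to [l]. *)
Lemma sides_disjoint k k' l v : adj k l -> adj k' l -> k <> k' ->
  side k l v -> ~ side k' l v.
Proof.
move=> kl k'l kk' [p kp lastp] k'v.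
case/shortenP: kp lastp => q kq _ _ lastq.
have lq : inr l \notin inl k :: q.
  apply/negP => lq; apply: (side_bridge kl).
  case/splitPl: lq kq => q1 q2 lastq1; rewrite cat_path => /andP[kq1 _].
  by exists q1.
have kq' : path (bip_edge adj) (inl k) q by apply: sub_path kq => a b /and3P[].
apply: (side_bridge k'l); apply: reachable_trans k'v _.
apply: (@reachable_trans _ _ (inl k)).
  apply: reachable_sym (delete_edge_sym k' l) _; exists q => //.
  by apply: path_delete_edge kq' _ lq; right.
apply: reachable1; rewrite /delete_edge /= kl eqxx !andbT.
by apply/eqP => -[].
Qed.

(** The first step of a simple path from [k] to [v] is the direction of [v]; the
    rest of the path never returns to [k], hence survives the deletion of any
    edge at [k]. *)
Lemma side_direction k v : v != inl k ->
  exists l, [/\ adj k l, ~ side k l v & forall l', l' <> l -> side k l' v].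
Proof.
move=> vk; have [_ conn _] := tree; have [p kp lastp] := conn (inl k) v.
case/shortenP: kp lastp => p' kp' /= up' _ lastp'.
case: p' kp' up' lastp' => [_ _ kv|w q]; first by rewrite -kv eqxx in vk.
case: w => [//|l] /= /andP[kl lq] /andP[kq uq] lastq.
have del l' : path (delete_edge k l') (inr l) q.
  by apply: path_delete_edge lq _ kq; left.
exists l; split=> //.
  move=> kv; apply: (side_bridge kl); apply: reachable_trans kv _.
  apply: reachable_sym (delete_edge_sym k l) _.
  by exists q.
move=> l' l'l; apply: (@reachable_trans _ _ (inr l)); last by exists q.
apply: reachable1; rewrite /delete_edge /= kl eqxx /= andbT.
by apply/eqP => -[ll']; apply: l'l.
Qed.

Lemma side_neighbor l v : v != inr l -> exists2 k, adj k l & side k l v.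
Proof.
move=> vl; have [_ conn _] := tree; have [p lp lastp] := conn (inr l) v.
case/shortenP: lp lastp => p' lp' /= up' _ lastp'.
case: p' lp' up' lastp' => [_ _ lv|w q]; first by rewrite -lv eqxx in vl.
case: w => [k|//] /= /andP[kl kq] /andP[lq uq] lastq.
exists k => //; exists q => //; apply: path_delete_edge kq _ lq; by right.
Qed.

(** Otherwise there would be a cycle of length 4. *)
Lemma adj_common k k' l l' : k <> k' -> l <> l' ->
  adj k l -> adj k' l -> adj k' l' -> ~ adj k l'.
Proof.
move=> /eqP kk' /eqP ll' kl k'l k'l' kl'; have [_ _ acyclic] := tree.
have cyc : cycle (bip_edge adj) [:: inl k; inr l; inl k'; inr l'].
  by rewrite /= kl k'l k'l' kl'.
have uniq4 : uniq [:: inl k; inr l; inl k'; inr l'].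
  have kk : (inl k == inl k' :> (K + L)%type) = false.
    by apply: contraNF kk' => /eqP[->].
  have ll : (inr l == inr l' :> (K + L)%type) = false.
    by apply: contraNF ll' => /eqP[->].
  by rewrite /= !inE kk ll.
by have := acyclic _ cyc uniq4.
Qed.

End tree_sides.

(** * Branches of a tree of spaces *)

Section realization.
Context (K L : choiceType) (adj : K -> L -> bool) (R : realType).
Implicit Types (k : K) (l : L) (u v : (K + L)%type).

Lemma vertex_pt_pos v u : 0 < vertex_pt v u :> R -> u = v.
Proof. by rewrite /vertex_pt; case: eqVneq => //; rewrite ltxx. Qed.

Lemma vertex_pt_self v : 0 < vertex_pt v v :> R.
Proof. by rewrite /vertex_pt eqxx ltr01. Qed.

Lemma realization_cases (a : realization adj R) :
  (exists v, set_val a = vertex_pt v) \/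
  (exists k l s, [/\ adj k l, 0 < s < 1 & set_val a = edge_pt k l s]).
Proof.
have [[v _ va]|[[k l] /= kl [s /=]]] := set_mem (valP a).
  by left; exists v; exact/esym.
rewrite in_itv /= => /andP[s0 s1] sa.
have vertex v : edge_pt k l s = vertex_pt v ->
    (exists v, set_val a = vertex_pt v) \/
    (exists k l s, [/\ adj k l, 0 < s < 1 & set_val a = edge_pt k l s]).
  by move=> v_; left; exists v; apply: etrans (esym sa) v_.
move: s0; rewrite le_eqVlt => /predU1P[s0|s0].
  apply: (vertex (inl k)); apply/funext => u.
  by rewrite /edge_pt -s0 subr0 mul1r mul0r addr0.
move: s1; rewrite le_eqVlt => /predU1P[s1|s1].
  apply: (vertex (inr l)); apply/funext => u.
  by rewrite /edge_pt s1 subrr mul1r mul0r add0r.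
by right; exists k, l, s; rewrite s0 s1; split=> //; exact/esym.
Qed.

Lemma edge_pt_pos k l (s : R) u : 0 < edge_pt k l s u -> u = inl k \/ u = inr l.
Proof.
rewrite /edge_pt /vertex_pt; case: (eqVneq u (inl k)) => [->|_]; first by left.
case: (eqVneq u (inr l)) => [->|_]; first by right.
by rewrite !mulr0 addr0 ltxx.
Qed.

Lemma edge_pt_posl k l (s : R) : s < 1 -> 0 < edge_pt k l s (inl k).
Proof. by move=> s1; rewrite /edge_pt /vertex_pt eqxx mulr1 mulr0 addr0 subr_gt0. Qed.

Lemma support_adj (a : realization adj R) u v :
  0 < set_val a u -> 0 < set_val a v -> u = v \/ bip_edge adj u v.
Proof.
have [[w ->]|[k [l [s [kl _ ->]]]]] := realization_cases a.
  by move=> /vertex_pt_pos -> /vertex_pt_pos ->; left.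
by move=> /edge_pt_pos[]-> /edge_pt_pos[]->; [left|right|right|left].
Qed.

Lemma support_nonempty (a : realization adj R) : exists v, 0 < set_val a v.
Proof.
have [[w ->]|[k [l [s [kl /andP[s0 s1] ->]]]]] := realization_cases a.
  by exists w; exact: vertex_pt_self.
by exists (inl k); exact: edge_pt_posl.
Qed.

Lemma support_vertex (a : realization adj R) l :
  (forall u, 0 < set_val a u -> u = inr l) -> set_val a = vertex_pt (inr l).
Proof.
have [[w ->]|[k [l' [s [kl /andP[s0 s1] ->]]]]] := realization_cases a.
  by move=> /(_ _ (vertex_pt_self w)) ->.
by move=> /(_ _ (edge_pt_posl k l' s1)).
Qed.

Lemma closed_starP (a : realization adj R) k : closed_star adj k (set_val a) <->
  0 < set_val a (inl k) \/
  exists2 l, adj k l & set_val a = vertex_pt (inr l).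
Proof.
split.
  move=> [->|[l kl [s /=]]]; first by left; exact: vertex_pt_self.
  rewrite in_itv /= => /andP[s0 s1] sa.
  have [{}s1|s1'] := ltP s 1; first by left; rewrite -sa; exact: edge_pt_posl.
  right; exists l => //; rewrite -sa.
  have -> : s = 1 by apply/eqP; rewrite eq_le s1.
  by apply/funext => u; rewrite /edge_pt subrr mul1r mul0r add0r.
have [[w ->]|[k' [l [s [kl /andP[s0 s1] ->]]]]] := realization_cases a.
  move=> [/vertex_pt_pos <-|[l kl wl]]; first by left.
  right; exists l => //; rewrite wl; exists 1; first by rewrite /= in_itv /= ler01 lexx.
  by apply/funext => u; rewrite /edge_pt subrr mul1r mul0r add0r.
have e : closed_edge k' l (edge_pt k' l s).
  by exists s => //; rewrite /= in_itv /= !ltW.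
move=> [/edge_pt_pos[]// [->]|[l' kl' sl']]; first by right; exists l.
have := edge_pt_posl k' l s1; rewrite sl' => /vertex_pt_pos //.
Qed.

Lemma support_outside_star (a : realization adj R) k :
  ~ closed_star adj k (set_val a) ->
  exists v, [/\ 0 < set_val a v, v != inl k & forall l, adj k l -> v != inr l].
Proof.
rewrite closed_starP => na.
have [[w aw]|[k' [l [s [kl /andP[s0 s1] aw]]]]] := realization_cases a.
  exists w; split.
  - by rewrite aw; exact: vertex_pt_self.
  - apply/eqP => wk; apply: na; left; rewrite aw wk; exact: vertex_pt_self.
  - by move=> l kl; apply/eqP => wl; apply: na; right; exists l => //; rewrite aw wl.
exists (inl k'); split=> //.
  by rewrite aw; exact: edge_pt_posl.
apply/eqP => -[kk']; apply: na; left; rewrite -kk' aw; exact: edge_pt_posl.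
Qed.

End realization.

Section geodesics_and_open_sets.
Context (R : realType) (Z : metricType R).

(** Segments are connected. *)
Lemma geodesic_meets (U U' : set Z) (x y : Z) : geodesic_space Z ->
  open U -> open U' -> U `&` U' = set0 -> U x -> ~ U y ->
  exists z, [/\ ~ U z, ~ U' z & mdist x y = mdist x z + mdist z y].
Proof.
move=> geoZ oU oU' UU' Ux nUy; have [h [h0 h1 hd]] := geoZ x y.
have [[t t01 [nU nU']]|cov] :=
    pselect (exists2 t, 0 <= t <= 1 & ~ U (h t) /\ ~ U' (h t)).
  exists (h t); split=> //; case/andP: (t01) => t0 t1.
  have i0 : 0 <= (0 : R) <= 1 by rewrite lexx ler01.
  have i1 : 0 <= (1 : R) <= 1 by rewrite lexx ler01.
  have -> : mdist x (h t) = t * mdist x y.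
    by have := hd 0 t i0 t01; rewrite h0 sub0r normrN ger0_norm.
  have -> : mdist (h t) y = (1 - t) * mdist x y.
    by have := hd t 1 t01 i1; rewrite h1 distrC ger0_norm// subr_ge0.
  by rewrite -mulrDl addrC subrK mul1r.
exfalso; pose A : set Z := h @` `[0, 1].
have AUU' z : A z -> U z \/ U' z.
  move=> [t]; rewrite /= in_itv /= => t01 <-; apply: contrapT => /not_orP nUU'.
  by apply: cov; exists t.
have Ay : A y by exists 1 => //; rewrite /= in_itv /= ler01 lexx.
have Ax : A x by exists 0 => //; rewrite /= in_itv /= ler01 lexx.
have connA : connected A.
  apply: connected_continuous_connected; first exact: segment_connected.
  apply/subspace_continuousP => s; rewrite /= in_itv /= => s01.
  apply/cvg_ballP => eps eps0; rewrite near_withinE.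
  have d0 : 0 < mdist x y + 1 by rewrite ltr_wpDl ?mdist_ge0 ?ltr01.
  near=> t => t01; rewrite ballEmdist /=.
  move: t01; rewrite set_itvE /= => t01; rewrite hd//.
  have : `|s - t| < eps / (mdist x y + 1).
    near: t; apply: cvgr_dist_lt; [exact: cvg_id|exact: divr_gt0].
  rewrite ltr_pdivlMr// => /(le_lt_trans _); apply.
  by rewrite ler_wpM2l// lerDl.
have UA : A `&` U = A.
  apply: connA.
  - by exists x.
  - by exists U.
  - exists (~` U'); first exact: open_closedC.
    apply/seteqP; split=> z [Az] h'; split=> //.
      by move=> U'z; rewrite -[False]/(set0 z) -UU'.
    by have [] := AUU' _ Az.
by apply: nUy; move: Ay; rewrite -UA => -[].
Unshelve. all: by end_near. Qed.

End geodesics_and_open_sets.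

Section branches.
Context (R : realType) (Z : metricType R) (K L : choiceType)
  (adj : K -> L -> bool) (xi : Z -> realization adj R).
Hypotheses (geoZ : geodesic_space Z) (tree : bipartite_tree adj)
  (xic : continuous xi).
Variable pt : L -> Z.
Hypothesis ptE : forall l, L_fiber xi l = [set pt l].

Definition in_support (v : (K + L)%type) : set Z := [set z | 0 < set_val (xi z) v].

Lemma open_in_support v : open (in_support v).
Proof.
have cont : continuous (fun z : Z => set_val (xi z) v).
  move=> z.
  apply: (@continuous_comp _ _ _ (fun z => set_val (xi z)) (proj v)).
    apply: (@continuous_comp _ _ _ xi set_val); first exact: xic.
    exact: initial_continuous.
  exact: proj_continuous.
have -> : in_support v = (fun z : Z => set_val (xi z) v) @^-1` [set x | 0 < x].
  by [].
by apply: open_comp => // z _; exact: cont.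
Qed.

Lemma pt_fiber l : set_val (xi (pt l)) = vertex_pt (inr l).
Proof. by have : [set pt l] (pt l) by []; rewrite -ptE. Qed.

Lemma fiber_pt z l : set_val (xi z) = vertex_pt (inr l) -> z = pt l.
Proof. by move=> zl; have : L_fiber xi l z by []; rewrite ptE. Qed.

Lemma in_support_pt v l : in_support v (pt l) -> v = inr l.
Proof. by rewrite /in_support/= pt_fiber => /vertex_pt_pos. Qed.

Lemma pt_inj : injective pt.
Proof.
move=> l l' ll'; have : in_support (inr l) (pt l).
  by rewrite /in_support/= pt_fiber; exact: vertex_pt_self.
by rewrite ll' => /in_support_pt[].
Qed.

Lemma neq_pt z l : z <> pt l -> exists2 v, in_support v z & v != inr l.
Proof.
move=> zl; apply: contrapT => nv; apply/zl/fiber_pt/support_vertex => u zu.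
by apply: contrapT => /eqP ul; apply: nv; exists u.
Qed.

Lemma piece_pt k l : adj k l -> piece xi k (pt l).
Proof.
by move=> kl; apply/closed_starP; right; exists l => //; exact: pt_fiber.
Qed.

(** A point above the interior of an edge has both ends of that edge in its
    support, so this is the part of [Z] above a half-tree minus [pt l]; it is
    open and its complement minus [pt l] is open too. *)
Definition branch k l : set Z := [set z | exists2 v, side adj k l v & in_support v z].

Lemma branch_piece k l z : adj k l -> piece xi k z -> z <> pt l -> branch k l z.
Proof.
move=> kl /closed_starP[zk|[l' kl' zl']] zl; first by exists (inl k) => //; exists [::].
exists (inr l'); last by rewrite /in_support/= zl'; exact: vertex_pt_self.
apply: (@side_closed _ _ _ k l (inl k)) => //; first by exists [::].
by apply/eqP => -[l'l]; apply: zl; rewrite -l'l; exact: fiber_pt.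
Qed.

(** Geodesics leaving the branch pass through [pt l], the only point of [Z] in
    neither of the open sets above the two half-trees. *)
Lemma branch_cut k l : adj k l -> cut_set (pt l) (branch k l).
Proof.
move=> kl; split=> [[v kv /in_support_pt vl]|x y kx nky].
  by apply: (side_bridge tree kl); rewrite -vl.
pose U' := \bigcup_(v in [set v | ~ side adj k l v /\ v != inr l]) in_support v.
have bE : branch k l = \bigcup_(v in side adj k l) in_support v by [].
have [|||z [nz nz' ->]] := @geodesic_meets _ _ (branch k l) U' x y geoZ _ _ _ kx nky.
- by rewrite bE; apply: bigcup_open => v _; exact: open_in_support.
- by apply: bigcup_open => v _; exact: open_in_support.
- apply/seteqP; split=> // z [[u ku uz] [v [nkv vl] vz]].
  by case: (support_adj uz vz) nkv => [<-//|uv]; apply; exact: side_closed uv _.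
suff -> : z = pt l by [].
apply/fiber_pt/support_vertex => u uz; apply: contrapT => /eqP ul.
have [ku|nku] := pselect (side adj k l u); first by apply: nz; exists u.
by apply: nz'; exists u.
Qed.

Lemma branch_support k l z v : adj k l -> in_support v z -> v != inr l ->
  branch k l z -> side adj k l v.
Proof.
move=> kl vz vl [u ku uz].
by case: (support_adj uz vz) => [<-//|uv]; exact: side_closed uv _.
Qed.

(** The cut point by which [z] is attached to the piece: it is given by the
    direction from [k] of any vertex of the support of [z] outside of the star
    of [k]. *)
Lemma piece_gate k z : ~ piece xi k z ->
  exists l, [/\ adj k l, ~ branch k l z, z <> pt l &
                forall l', l' <> l -> branch k l' z].
Proof.
move=> nkz; have [v [vz vk vl]] := support_outside_star nkz.
have [l [kl nkv kv]] := side_direction tree vk; exists l; split=> //.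
- by move=> /(branch_support kl vz (vl _ kl)).
- by move=> zl; move: vz; rewrite zl => /in_support_pt/eqP; exact/negP/vl.
- by move=> l' l'l; exists v => //; exact: kv.
Qed.

Lemma branch_neighbor l z : z <> pt l -> exists2 k, adj k l & branch k l z.
Proof.
move=> /neq_pt[v vz vl]; have [k kl kv] := side_neighbor tree vl.
by exists k => //; exists v.
Qed.

(** Distinct pieces only meet above common neighbors in the tree, and two such
    neighbors would make a cycle. *)
Lemma piece_unique k k' x y : x <> y -> piece xi k x -> piece xi k y ->
  piece xi k' x -> piece xi k' y -> k = k'.
Proof.
move=> xy kx ky k'x k'y; apply: contrapT => kk'.
have common z : piece xi k z -> piece xi k' z ->
    exists l, [/\ adj k l, adj k' l & z = pt l].
  have excl j j' : j <> j' -> in_support (inl j) z -> piece xi j' z -> False.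
    move=> jj' jz /closed_starP[j'z|[l _ zl]].
      by case: (support_adj jz j'z) => [[]|].
    by move: jz; rewrite /in_support/= zl => /vertex_pt_pos.
  move=> kz k'z; have /closed_starP[jz|[l kl zl]] := kz; first by case: (excl k k').
  have /closed_starP[jz|[l' kl' zl']] := k'z.
    by case: (excl k' k) => // k'k; apply: kk'.
  exists l; split=> //; last exact: fiber_pt.
  have := vertex_pt_self R (inr l : (K + L)%type).
  by rewrite -zl zl' => /vertex_pt_pos[->].
have [l [kl k'l xl]] := common x kx k'x; have [l' [kl' k'l' yl']] := common y ky k'y.
have ll' : l <> l' by move=> ll'; apply: xy; rewrite xl yl' ll'.
exact: (adj_common tree kk' ll' kl k'l k'l').
Qed.

Lemma exists_piece (e x : Z) : x <> e -> exists k, piece xi k e.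
Proof.
move=> xe; have [v ve] := support_nonempty (xi e).
case: v ve => [k|l] ve; first by exists k; apply/closed_starP; left.
have [el|el] := pselect (e = pt l).
  rewrite el in xe *; have [k kl _] := branch_neighbor xe.
  by exists k; exact: piece_pt.
have [[k|l'] ve' vl] := neq_pt el; first by exists k; apply/closed_starP; left.
by case: (support_adj ve ve') => [[ll']|//]; move: vl; rewrite ll' eqxx.
Qed.

(** The supports of the vertices form an open cover, and each contains at most
    one cut point. *)
Lemma finite_cut_points (z : Z) r : proper_space Z ->
  finite_set [set l | mdist z (pt l) <= r].
Proof.
move=> prZ.
apply: (@compact_ideal Z [set y | mdist z y <= r]
  (fun A => finite_set [set l | A (pt l)])) => //.
- by move=> A B fA fB; rewrite -[X in finite_set X]/(_ `|` _) finite_setU.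
- by move=> A B AB; apply: sub_finite_set => l /AB.
- move=> y _; have [v vy] := support_nonempty (xi y).
  exists (in_support v).
    by apply: open_nbhs_nbhs; split=> //; exact: open_in_support.
  case: v vy => [k|l] vy.
    by apply: sub_finite_set (finite_set0 _) => l /in_support_pt.
  by apply: sub_finite_set (finite_set1 l) => l' /in_support_pt[->].
Qed.

End branches.

(** * The boundaries of the pieces inside the boundary of the tree *)

Section basepoint.
Context (R : realType) (X : metricType R) (g : bicombing X) (E C : R).
Hypothesis gcc : geodesic_coarsely_convex E C g.

Let D e1 e2 M : R := E * M + C + 2 * ((E + 1) * @mdist _ X e1 e2 + C).

Lemma fellow_basepoint_add e1 e2 M t x y : 0 <= t ->
  fellow g e1 M (t + mdist e1 e2) x y -> fellow g e2 (D e1 e2 M) t x y.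
Proof.
move=> t0 f; have le : mdist e1 e2 <= t + mdist e1 e2 by rewrite lerDr.
by have := fellow_basepoint gcc le f; rewrite addrK.
Qed.

Lemma asymptotic_basepoint e1 e2 u v : asymptotic g e1 u v -> asymptotic g e2 u v.
Proof.
move=> [M uM]; exists (D e1 e2 M) => t t0.
have [|N NP] := uM (t + mdist e1 e2); first by rewrite addr_ge0// mdist_ge0.
by exists N => i /NP; exact: fellow_basepoint_add.
Qed.

Lemma infinity_basepoint e1 e2 u : going_to_infinity g e1 u -> going_to_infinity g e2 u.
Proof.
move=> [M uM]; exists (D e1 e2 M) => t t0.
have [|N NP] := uM (t + mdist e1 e2); first by rewrite addr_ge0// mdist_ge0.
by exists N => i j Ni Nj; apply: fellow_basepoint_add => //; exact: NP.
Qed.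

End basepoint.

Section tree.
Context (R : realType) (Z : metricType R) (K L : choiceType)
  (adj : K -> L -> bool) (xi : Z -> realization adj R)
  (gk : forall k : K, bicombing (piece xi k)) (E' C' E C : R)
  (e : Z) (ek : forall k : K, piece xi k).
Hypotheses (gccZ : tree_of_gcc_spaces gk E' C') (prZ : proper_space Z)
  (gcc : geodesic_coarsely_convex E C (tree_bicombing gk)).

Let geoZ : geodesic_space Z. Proof. by case: gccZ => -[]. Qed.
Let tree : bipartite_tree adj. Proof. by case: gccZ => -[]. Qed.
Let xic : continuous xi. Proof. by case: gccZ => -[]. Qed.
Let gcck k : geodesic_coarsely_convex E' C' (@gk k). Proof. by case: gccZ. Qed.

Local Notation g := (tree_bicombing gk).
Local Notation dZ := (ideal_boundary e g E C).
Local Notation dX k := (ideal_boundary (ek k) (@gk k) E' C').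

Variable pt : L -> Z.
Hypothesis ptE : forall l, L_fiber xi l = [set pt l].

Let cut k l (kl : adj k l) := branch_cut geoZ tree xic ptE kl.

Lemma piece_val k (x : piece xi k) : piece xi k (set_val x).
Proof. exact: set_mem (valP x). Qed.

(** The piece chosen in [piece_bicombing] is [k], two distinct points being in at
    most one common piece. *)
Lemma tree_bicombing_piece k (x y : piece xi k) t : x <> y ->
  g (set_val x) (set_val y) t = set_val (gk x y t).
Proof.
move=> xy; have kx := piece_val x; have ky := piece_val y.
rewrite /tree_bicombing asboolT; last by exists k.
rewrite /piece_bicombing; case: pselect => [h|]; last by case; exists k.
case: (cid h) => k' [k'x k'y] /=.
have kk' : k = k'.
  apply: (piece_unique tree ptE _ kx ky k'x k'y).
  by move=> /val_inj.
case: _ / kk' in k'x k'y *.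
by congr (set_val (gk _ _ t)); exact: val_inj.
Qed.

Lemma arclength_piece k (x y : piece xi k) t :
  arclength_geod g (set_val x) (set_val y) t =
  set_val (arclength_geod (@gk k) x y t).
Proof.
rewrite /arclength_geod; case: (eqVneq x y) => [->|xy]; first by rewrite !eqxx.
have -> : set_val x != set_val y by apply: contra xy => /eqP/val_inj ->.
case: ifP => //= _; apply: tree_bicombing_piece; exact/eqP.
Qed.

Lemma fellow_piece k (x y z : piece xi k) M t :
  fellow g (set_val x) M t (set_val y) (set_val z) <-> fellow (@gk k) x M t y z.
Proof. by rewrite /fellow !arclength_piece. Qed.

Lemma infinity_piece k (x : piece xi k) (u : nat -> piece xi k) :
  going_to_infinity g (set_val x) (set_val \o u) <-> going_to_infinity (@gk k) x u.
Proof.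
split=> -[M uM]; exists M => t t0; have [N NP] := uM t t0; exists N => i j Ni Nj.
  exact/fellow_piece/NP.
exact/fellow_piece/NP.
Qed.

Lemma asymptotic_piece k (x : piece xi k) (u v : nat -> piece xi k) :
  asymptotic g (set_val x) (set_val \o u) (set_val \o v) <->
  asymptotic (@gk k) x u v.
Proof.
split=> -[M uM]; exists M => t t0; have [N NP] := uM t t0; exists N => i Ni.
  exact/fellow_piece/NP.
exact/fellow_piece/NP.
Qed.

(** The map of boundaries induced by the inclusion of a piece. *)
Definition inclusion_spec k (phi : dX k -> dZ) :=
  forall (a : dX k) u, set_val a u -> set_val (phi a) (set_val \o u).

Lemma exists_inclusion k : exists phi : dX k -> dZ, inclusion_spec phi.
Proof.
suff /choice[phi phiP] : forall a : dX k, exists c : dZ,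
    forall u, set_val a u -> set_val c (set_val \o u) by exists phi.
move=> a; have [u au] := boundary_reps (gcck k) a.
have [c cu] : exists c : dZ, set_val c (set_val \o u).
  apply: (boundary_class gcc); apply: (infinity_basepoint gcc (e1 := set_val (ek k))).
  exact/infinity_piece/(reps_infinity (gcck k) au).
exists c => v av; apply: (asymptotic_reps gcc cu).
apply: (asymptotic_basepoint gcc (e1 := set_val (ek k))).
exact/asymptotic_piece/(reps_asymptotic (gcck k) au av).
Qed.

Section one_piece.
Variables (k : K) (phi : dX k -> dZ).
Hypothesis phiP : inclusion_spec phi.

(** Fellow travelling at time [m] persists, at a bounded loss of time and
    distance, under a change of base point; the entourages compare. *)
Lemma inclusion_entourage n : exists m, forall a b : dX k,
  boundary_entourage m a b -> boundary_entourage n (phi a) (phi b).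
Proof.
pose d := mdist (set_val (ek k)) e; have d0 : 0 <= d by exact: mdist_ge0.
pose M0 := cst_D2 E' C' + cst_D2 E' C' + cst_D2 E' C'.
pose M := E * M0 + C + 2 * ((E + 1) * d + C).
pose l := Num.max 1 M; have l1 : 1 <= l by rewrite le_max lexx.
have l0 : 0 <= l by exact: le_trans l1.
pose m := (Num.truncn (n%:R * l + d)).+1.
have mP : n%:R * l + d < m%:R by exact: Num.Theory.truncnS_gt.
have nl0 : 0 <= n%:R * l by exact: mulr_ge0.
exists m => a b ab.
have [u au] := boundary_reps (gcck k) a; have [v bv] := boundary_reps (gcck k) b.
have [N NP] := boundary_entourage_fellow (gcck k) ab au bv.
apply: (fellow_boundary_entourage gcc (M := M) (t := m%:R - d) _ l1 _ _
  (phiP au) (phiP bv)).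
- by lra.
- by rewrite le_max lexx orbT.
- by lra.
- exists N => i Ni; apply: (fellow_basepoint_add gcc (e1 := set_val (ek k))).
    by lra.
  by rewrite -/d subrK; apply/fellow_piece/NP.
Qed.

Lemma entourage_inclusion n : exists m, forall a b : dX k,
  boundary_entourage m (phi a) (phi b) -> boundary_entourage n a b.
Proof.
pose d := mdist e (set_val (ek k)); have d0 : 0 <= d by exact: mdist_ge0.
pose M0 := cst_D2 E C + cst_D2 E C + cst_D2 E C.
pose M := E * M0 + C + 2 * ((E + 1) * d + C).
pose l := Num.max 1 M; have l1 : 1 <= l by rewrite le_max lexx.
have l0 : 0 <= l by exact: le_trans l1.
pose m := (Num.truncn (n%:R * l + d)).+1.
have mP : n%:R * l + d < m%:R by exact: Num.Theory.truncnS_gt.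
have nl0 : 0 <= n%:R * l by exact: mulr_ge0.
exists m => a b ab.
have [u au] := boundary_reps (gcck k) a; have [v bv] := boundary_reps (gcck k) b.
have [N NP] := boundary_entourage_fellow gcc ab (phiP au) (phiP bv).
apply: (fellow_boundary_entourage (gcck k) (M := M) (t := m%:R - d) _ l1 _ _
  au bv).
- by lra.
- by rewrite le_max lexx orbT.
- by lra.
- exists N => i Ni; apply/fellow_piece; apply: (fellow_basepoint_add gcc (e1 := e)).
    by lra.
  by rewrite -/d subrK; exact: NP.
Qed.

Lemma inclusion_embedding : entourage_embedding (@boundary_entourage _ _ g E C e) phi.
Proof.
split.
  apply/continuousP => O /boundary_openP oO; apply/boundary_openP => a Oa.
  have [n nO] := oO _ Oa; have [m mn] := inclusion_entourage n.
  by exists m => b /mn/nO.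
move=> O /boundary_openP oO a Oa; have [n nO] := oO _ Oa.
by have [m mn] := entourage_inclusion n; exists m => b /mn/nO.
Qed.

Definition beyond l : set Z := [set z | ~ branch xi k l z /\ z <> pt l].

Lemma beyond_cut l : adj k l -> cut_set (pt l) (beyond l).
Proof. by move=> kl; exact: cut_setC (cut kl). Qed.

Lemma piece_not_beyond l z : adj k l -> piece xi k z -> ~ beyond l z.
Proof. by move=> kl kz [nb zl]; apply: nb; exact: (branch_piece ptE). Qed.

(** Projecting a representative to the piece, via its cut points, moves it to
    a fellow traveller, unless infinitely many of its points project to a
    bounded set, which has finitely many cut points, hence to the same one. *)
Lemma boundary_beyond (c : dZ) : ~ range phi c ->
  exists2 l, adj k l & boundary_of (beyond l) c.
Proof.
move=> nc; apply: contrapT => nl; apply: nc.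
have {}nl l : adj k l -> ~ boundary_of (beyond l) c.
  by move=> kl lc; apply: nl; exists l.
have [u cu] := boundary_reps gcc c.
have ui := infinity_basepoint gcc (set_val (ek k)) (reps_infinity gcc cu).
have /choice[w wP] : forall i, exists w : piece xi k, u i = set_val w \/
    exists l, [/\ adj k l, beyond l (u i) & set_val w = pt l].
  move=> i; have [ki|nki] := pselect (piece xi k (u i)).
    by exists (SigSub (mem_set ki)); left.
  have [l [kl nb zl _]] := piece_gate tree ptE nki.
  have pl := piece_pt ptE kl.
  by exists (SigSub (mem_set pl)); right; exists l.
have wfar t : exists N : nat, forall i : nat, (N <= i)%N ->
    t <= mdist (set_val (ek k)) (set_val (w i)).
  have [N0 N0P] := infinity_unbounded ui t.
  have [N1 N1P] : exists N : nat, forall i : nat, (N <= i)%N -> forall l,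
      mdist (set_val (ek k)) (pt l) <= t -> adj k l -> ~ beyond l (u i).
    have /finite_seqP[s sE] := finite_cut_points xic ptE (set_val (ek k)) t prZ.
    suff [N NP] : exists N : nat, forall i : nat, (N <= i)%N -> forall l,
        l \in s -> adj k l -> ~ beyond l (u i).
      exists N => i Ni l lt; apply: NP => //.
      by have : [set` s] l by rewrite -sE.
    elim: s {sE} => [|l s [N NP]]; first by exists 0%N.
    have [N' N'P] : exists N' : nat, forall i : nat, (N' <= i)%N ->
        adj k l -> ~ beyond l (u i).
      have [kl|nkl] := boolP (adj k l); last by exists 0%N.
      have [N' N'P] := not_boundary_of_rep gcc (beyond_cut kl) (nl _ kl) cu.
      by exists N' => i /N'P.
    exists (maxn N N') => i; rewrite geq_max => /andP[Ni N'i] l'.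
    by rewrite inE => /predU1P[->|l's]; [exact: N'P|exact: NP].
  exists (maxn N0 N1) => i; rewrite geq_max => /andP[N0i N1i].
  have [<-|[l [kl lu wl]]] := wP i; first exact: N0P.
  rewrite leNgt; apply/negP => /ltW lt; apply: (N1P i N1i l _ kl lu).
  by rewrite -wl.
have uw : asymptotic g (set_val (ek k)) u (set_val \o w).
  exists (E * 0 + C) => t t0; have [N NP] := wfar t; exists N => i /NP tw.
  apply: (fellow_shrink gcc (t := mdist (set_val (ek k)) (set_val (w i)))).
    by rewrite t0.
  have [-> /=|[l [kl lu wl]] /=] := wP i; first exact: fellow_refl.
  have nek : ~ beyond l (set_val (ek k)).
    by apply: piece_not_beyond => //; exact: piece_val.
  rewrite wl; split=> //.
    by rewrite (cut_set_dist (beyond_cut kl) nek lu) lerDl mdist_ge0.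
  rewrite (arclength_cut_point gcc (beyond_cut kl) nek lu).
  by rewrite (arclength_end gcc (lexx _)) mdistxx.
have cw : set_val c (set_val \o w).
  exact: (asymptotic_reps gcc cu (asymptotic_basepoint gcc e uw)).
have [a aw] : exists a : dX k, set_val a w.
  apply: (boundary_class (gcck k)); apply/infinity_piece.
  exact: (asymptotic_infinity uw ui).
exists a => //; apply: (asymptotic_eq gcc (phiP aw) cw).
exact: asymptotic_refl (reps_infinity gcc cw).
Qed.

Lemma clopen_separated_inclusion : clopen_separated (range phi).
Proof.
move=> c /boundary_beyond[l kl lc]; exists (~` boundary_of (beyond l)).
have [oD cD] := clopen_boundary_of e gcc (beyond_cut kl).
split; last by apply.
  by split; [exact: closed_openC|exact: open_closedC].
move=> _ [a _ <-]; have [u au] := boundary_reps (gcck k) a.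
move=> /(boundary_of_rep gcc (beyond_cut kl)) /(_ (phiP au)) [N /(_ N (leqnn N))].
exact/piece_not_beyond/piece_val.
Qed.

End one_piece.

(** * Boundary points outside of the boundaries of the pieces *)

Section ends.
Variable c : dZ.
Hypothesis c_end : forall k (phi : dX k -> dZ), inclusion_spec phi -> ~ range phi c.

Let beyond_end k : exists2 l, adj k l & boundary_of (beyond k l) c.
Proof.
have [phi phiP] := exists_inclusion k.
exact: (boundary_beyond phiP) (c_end phiP).
Qed.

(** [pt l] lies between the base point and [c]. *)
Definition separates_end l :=
  exists k, [/\ adj k l, ~ branch xi k l e & boundary_of (branch xi k l) c].

(** The representatives of [c] fellow travel, so that they all end up in the same
    branch at [pt l]; it is not a branch containing [e]. *)
Lemma beyond_separates_end k l : adj k l -> ~ beyond k l e ->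
  boundary_of (beyond k l) c -> separates_end l.
Proof.
move=> kl nle lc; have [u cu] := boundary_reps gcc c.
have [N NP] := boundary_of_rep gcc (beyond_cut kl) lc cu.
have D20 := cst_D2_ge0 gcc.
have t0 : 0 <= mdist e (pt l) + cst_D2 E C + 1.
  by have := mdist_ge0 e (pt l); lra.
have [N' N'P] := S_infty_fellow gcc
  ((S_inftyP e gcc u).2 (reps_infinity gcc cu)) t0.
set n := maxn N N'.
have [nbu ul] := NP n (leq_maxl _ _).
have [k' k'l bu] := branch_neighbor tree ptE ul.
have b_ i : (n <= i)%N -> branch xi k' l (u i).
  move=> ni; apply: (fellow_cut_set gcc (cut k'l) t0 _ _ bu); last first.
    by apply: N'P; [exact: leq_maxr|exact: leq_trans (leq_maxr _ _) ni].
  by lra.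
exists k'; split=> //; last by exists u; split=> //; exists n.
move=> k'e; apply: nle; split; last first.
  by move=> el; have [] := cut k'l; rewrite -el.
move=> [v kv ve].
have vl : v != inr l by apply/eqP => vl; apply: (side_bridge tree kl); rewrite -vl.
have k'v := branch_support k'l ve vl k'e.
have [kk'|kk'] := pselect (k = k'); first by apply: nbu; rewrite kk'.
exact: (sides_disjoint tree kl k'l kk' kv k'v).
Qed.

(** The point [c] enters the piece [k] by [pt l] and, not being in its boundary,
    leaves it by another cut point, farther away. *)
Lemma separates_end_next l : separates_end l ->
  exists2 l', separates_end l' & mdist e (pt l) < mdist e (pt l').
Proof.
move=> [k [kl nle lc]]; have [l' kl' l'c] := beyond_end k.
have [u cu] := boundary_reps gcc c.
have l'l : l' <> l.
  move=> l'l; rewrite l'l in l'c.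
  have [N NP] := boundary_of_rep gcc (beyond_cut kl) l'c cu.
  have [N' N'P] := boundary_of_rep gcc (cut kl) lc cu.
  have [nb _] := NP (maxn N N') (leq_maxl _ _); apply: nb.
  exact: N'P (leq_maxr _ _).
exists l'.
  apply: (beyond_separates_end kl' _ l'c) => l'e.
  have nke : ~ piece xi k e.
    by move=> ke; apply: (piece_not_beyond kl' ke).
  have [l0 [kl0 nl0e el0 others]] := piece_gate tree ptE nke.
  have [ll0|ll0] := pselect (l = l0); last by apply: nle; exact: others.
  have [nl'e _] := l'e.
  by apply: nl'e; apply: others => l'l0; apply: l'l; rewrite ll0.
have l'_branch : branch xi k l (pt l').
  apply: (branch_piece ptE kl); first exact: (piece_pt ptE).
  by move=> /(pt_inj ptE).
rewrite (cut_set_dist (cut kl) nle l'_branch) ltrDl mdist_gt0.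
by apply/eqP => /(pt_inj ptE) ll'; apply: l'l.
Qed.

Lemma exists_separates_end : exists l, separates_end l.
Proof.
have [u cu] := boundary_reps gcc c.
have [N NP] := infinity_unbounded (reps_infinity gcc cu) 1.
have ue : u N <> e.
  by move=> ue; have := NP N (leqnn N); rewrite ue mdistxx ler10.
have [k ke] := exists_piece tree ptE ue.
have [l kl lc] := beyond_end k; exists l.
by apply: (beyond_separates_end kl _ lc); exact: piece_not_beyond.
Qed.

(** Only finitely many cut points are in a given ball, and there is always a
    farther one. *)
Lemma separates_end_far r : exists2 l, separates_end l & r < mdist e (pt l).
Proof.
apply: contrapT => nfar.
have near l : separates_end l -> mdist e (pt l) <= r.
  by move=> sl; rewrite leNgt; apply/negP => far; apply: nfar; exists l.
have fin : finite_set separates_end.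
  exact: sub_finite_set near (finite_cut_points xic ptE e r prZ).
have [l sl lmax] := finite_set_max (fun l => mdist e (pt l)) fin exists_separates_end.
have [l' sl' ll'] := separates_end_next sl.
by have := lmax _ sl'; rewrite leNgt ll'.
Qed.

Lemma clopen_separated_outside : clopen_separated [set c].
Proof.
apply: (clopen_separated_end gcc) => r.
have [l [k [kl nle lc]] rl] := separates_end_far r.
by exists (pt l), (branch xi k l); split=> //; exact: cut.
Qed.

End ends.

Lemma dim_le_piece n k : dim_le dZ n -> dim_le (dX k) n.
Proof.
have [phi phiP] := exists_inclusion k.
apply: (dim_le_closed (boundary_entourage_base e gcc) (inclusion_embedding phiP)).
by apply: clopen_separated_closed; exact: (clopen_separated_inclusion phiP).
Qed.

Lemma dim_le_tree n : (forall k, dim_le (dX k) n) -> dim_le dZ n.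
Proof.
move=> dk; apply: (dim_le_clopen_separated (boundary_entourage_base e gcc)
  (boundary_compact gcc prZ)) => c.
have [[k [phi [phiP phic]]]|nc] := pselect (exists k (phi : dX k -> dZ),
    inclusion_spec phi /\ range phi c).
  exists (dX k), phi; split=> //; first exact: inclusion_embedding.
  exact: clopen_separated_inclusion.
have c_end k (phi : dX k -> dZ) : inclusion_spec phi -> ~ range phi c.
  by move=> phiP phic; apply: nc; exists k, phi.
exists (set_type [set c]), set_val.
have one (a b : set_type [set c]) : a = b.
  by apply: val_inj; rewrite (set_mem (valP a)) (set_mem (valP b)).
have rE : range (set_val : set_type [set c] -> dZ) = [set c].
  apply/seteqP; split=> [_ [a _ <-]|_ ->]; first exact: set_mem (valP a).
  by exists (SigSub (mem_set (erefl c : [set c] c))).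
rewrite rE; split=> //; last exact: clopen_separated_outside.
- split; first exact: initial_continuous.
  by move=> O _ a Oa; exists 0%N => b _; rewrite (one b a).
- exact: dim_le_subsingleton.
Qed.

End tree.

(** * The value of the covering dimension *)

Section covering_dim.
Context (R : realType).

Lemma dim_le_leq (V : topologicalType) m n : (m <= n)%N -> dim_le V m -> dim_le V n.
Proof.
move=> mn dV U /dV[W [Wcov WU ordW]]; exists W; split=> // x.
apply: card_le_trans (ordW x) _.
by apply: subset_card_le => i /= /leq_trans; apply.
Qed.

Lemma covering_dim_leP (V : topologicalType) (n : nat) :
  (covering_dim R V <= n%:R%:E)%E <-> dim_le V n.
Proof.
split=> [|dV]; last by apply: ereal_inf_lbound; exists n.
move=> dVn; have : (covering_dim R V < n.+1%:R%:E)%E.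
  by apply: le_lt_trans dVn _; rewrite lte_fin ltr_nat.
move=> /ereal_inf_lt[_ [m dV <-]]; rewrite lte_fin ltr_nat ltnS => mn.
exact: dim_le_leq mn dV.
Qed.

(** Dimensions are infima of upward closed sets of integers, so that a finite
    upper bound of dimensions, once rounded down, belongs to all these sets. *)
Lemma covering_dim_sup_dim (V : topologicalType) (I : Type)
    (B : I -> topologicalType) :
  (forall n, dim_le V n <-> forall i, dim_le (B i) n) ->
  covering_dim R V = sup_dim (fun i => covering_dim R (B i)).
Proof.
move=> VB; apply/eqP; rewrite eq_le; apply/andP; split; last first.
  apply: le_ereal_inf_tmp => _ [n dV <-]; apply: ge_ereal_sup.
  move=> _ [->|[i _ <-]]; first by rewrite lee_fin.
  by apply/covering_dim_leP; move: i; apply/VB.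
have s0 : (0 <= sup_dim (fun i => covering_dim R (B i)))%E.
  by apply: ereal_sup_ubound; left.
have sB i : (covering_dim R (B i) <= sup_dim (fun i => covering_dim R (B i)))%E.
  by apply: ereal_sup_ubound; right; exists i.
move: s0 sB; case: (sup_dim _) => [s| |] s0 sB //; last by rewrite leey.
rewrite lee_fin in s0.
apply: (@le_trans _ _ (Num.truncn s)%:R%:E); last first.
  by rewrite lee_fin Num.Theory.truncn_le.
apply/covering_dim_leP/VB => i; apply/covering_dim_leP.
have : (covering_dim R (B i) < (Num.truncn s).+1%:R%:E)%E.
  by apply: le_lt_trans (sB i) _; rewrite lte_fin Num.Theory.truncnS_gt.
move=> /ereal_inf_lt[_ [m dB <-]]; rewrite lte_fin ltr_nat ltnS => mn.
by apply/covering_dim_leP; exact: dim_le_leq mn dB.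
Qed.

End covering_dim.

Theorem theorem12p1 (R : realType) (Z : metricType R) (K L : choiceType)
    (adj : K -> L -> bool) (xi : Z -> realization adj R)
    (gk : forall k : K, bicombing (piece xi k)) (E' C' E C : R)
    (e : Z) (ek : forall k : K, piece xi k) :
  tree_of_gcc_spaces gk E' C' ->
  proper_space Z ->
  geodesic_coarsely_convex E C (tree_bicombing gk) ->
  covering_dim R (ideal_boundary e (tree_bicombing gk) E C) =
  sup_dim (fun k : K => covering_dim R (ideal_boundary (ek k) (gk k) E' C')).
Proof.
move=> gccZ prZ gcc.
have [[_ _ _ fibers _] _] := gccZ; have [pt ptE] := choice fibers.
apply: covering_dim_sup_dim => n; split=> [dZ k|].
  exact: (dim_le_piece gccZ prZ gcc ptE dZ).
exact: (dim_le_tree gccZ prZ gcc ptE).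
Qed.
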